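(* Let $m_1=3$, $m_2=4$, and $m_k=5$ for all $k\ge 3$. For all integers $n>k\ge 1$ there exists a (minimal) positive integer $h_k(n)$ such that the following holds: any family of at least $h_k(n)$ convex bodies in the plane such that any two members have at most $2k$ common supporting tangents and any $m_k$ members are in convex position contains $n$ members which are in convex position.
   Context: A convex body is a (nonempty) compact convex subset of $\mathbb{R}^2$. A family of sets is in convex position if no member is contained in the convex hull of the (union of the) other members. For a convex body $K$ let $g_K(\theta)=\max_{p\in K}\langle\theta,p\rangle$, $\theta\in\mathbb{S}^1$, be its support function. A common supporting tangent of two convex bodies $K,L$ is a line supporting both $K$ and $L$ with both bodies on the same side; these are counted as the directions $\theta\in\mathbb{S}^1$ with $g_K(\theta)=g_L(\theta)$ (so, for example, two distinct points have exactly two common supporting tangents). *)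

(* Defs.v *)
From mathcomp Require Import all_boot all_order all_algebra.
From mathcomp Require Import all_classical all_reals all_analysis.

Set Implicit Arguments.
Unset Strict Implicit.
Unset Printing Implicit Defensive.

Import Order.TTheory GRing.Theory Num.Theory.
Import numFieldNormedType.Exports.

Local Open Scope classical_set_scope.
Local Open Scope card_scope.
Local Open Scope ring_scope.

Definition dot (R : realType) (u v : 'rV[R]_2) : R :=
  \sum_(i < 2) u ord0 i * v ord0 i.

(* Defined from [dot] because the library norm on ['rV[R]_2] is the
   sup norm. *)
Definition unit_circle (R : realType) : set 'rV[R]_2 :=
  [set theta | dot theta theta = 1].

Definition convex_body (R : realType) (K : set 'rV[R]_2) : Prop :=
  [/\ K !=set0, compact K & @convex_set R 'rV[R]_2 K].

Definition convex_hull (R : realType) (A : set 'rV[R]_2) : set 'rV[R]_2 :=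
  smallest (@convex_set R 'rV[R]_2) A.

(* The supremum is attained, hence a maximum, when K is a convex body. *)
Definition support_function (R : realType) (K : set 'rV[R]_2)
    (theta : 'rV[R]_2) : R :=
  sup [set dot theta p | p in K].

Definition common_tangents (R : realType) (K L : set 'rV[R]_2) :
    set 'rV[R]_2 :=
  [set theta | @unit_circle R theta /\
               support_function K theta = support_function L theta].

Definition convex_position (R : realType) (F : set (set 'rV[R]_2)) : Prop :=
  forall K, F K -> ~ (K `<=` convex_hull (\bigcup_(L in F `\ K) L)).

Definition m_ (k : nat) : nat :=
  match k with
  | 1%N => 3%N
  | 2%N => 4%N
  | _ => 5%N
  end.

(* [F] may be infinite. *)
Definition admissible_family (R : realType) (k : nat)
    (F : set (set 'rV[R]_2)) : Prop :=
  [/\ forall K, F K -> convex_body K,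
      forall K L, F K -> F L -> K <> L ->
        common_tangents K L #<= `I_(2 * k)%N
    & forall G, G `<=` F -> G #= `I_(m_ k) -> convex_position G].

Definition forces_convex_position (R : realType) (k n h : nat) : Prop :=
  forall F : set (set 'rV[R]_2),
    admissible_family k F -> `I_h #<= F ->
    exists G : set (set 'rV[R]_2),
      [/\ G `<=` F, G #= `I_n & convex_position G].

(* Main.v *)
(** A body is covered by the hull of others iff its support function is at most
the maximum of theirs, so only the order of the support functions along the
circle of directions matters.  Sampling finitely many directions (one witness
for each body in each m_k-tuple, off all common tangents) turns the family into
a cyclic sequence of linear orders in which any two members are exchanged at
most 2k times.  Number the members by the initial order; for i < j let I(i,j)
be the set of times at which j is below i, a union of at most k intervals.
Then x is on top iff the time is in every I(x,j), j > x, and in no I(i,x),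
i < x.

By Ramsey's theorem all triples may be assumed to have the same pattern of
comparisons between the endpoints of their sets I, and, if no n members are in
convex position, all n-tuples may be assumed to fail at the same rank.  In a
uniform system, if t is outside I(i0,x) and I(i3,x), then t lies in I(i,x) for
at most one i strictly between i0 and i3; so three disjoint n-tuples around x,
with the same failing member x, show that x is already covered by four members
i0 < i1 < x < j0 < j1 (pigeonhole).  This contradicts the hypothesis on
5-tuples.  When each I is one interval, two of the four extreme members
suffice; when each I is two intervals, one shows that the only configuration
compatible with convex 4-tuples has sliding endpoints which contradict the
transitivity of the orders on a triple. *)
Require Import Defs.
From mathcomp Require Import all_boot all_order all_algebra.
From mathcomp Require Import all_classical all_reals all_analysis.
From mathcomp Require Import zify ring lra.

Set Implicit Arguments.
Unset Strict Implicit.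
Unset Printing Implicit Defensive.

Local Open Scope nat_scope.

(** * Ramsey's theorem *)

(** The induction on [s] colours a subsequence [u] of the tail by [chi (x :: u)], where [x] is the
    first element. An inner induction allows a separate target length for each colour and runs on
    their sum. *)
Lemma ramsey (C : finType) s n : exists N, forall (T : eqType)
    (chi : seq T -> C) (l : seq T), N <= size l ->
  exists l' c, [/\ subseq l' l, size l' = n &
    forall u, subseq u l' -> size u = s -> chi u = c].
Proof.
elim: s n => [|s IHs] n.
  exists n => T chi l nl; exists (take n l), (chi [::]); split.
  - exact: take_subseq.
  - by rewrite size_take_min (minn_idPl nl).
  - by move=> u _ /size0nil ->.
suff /(_ (fun=> n)) [N NP] : forall f : C -> nat, exists N, forall (T : eqType)
    (chi : seq T -> C) (l : seq T), N <= size l ->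
  exists l' c, [/\ subseq l' l, size l' = f c &
    forall u, subseq u l' -> size u = s.+1 -> chi u = c].
  by exists N.
move=> f; move: {2}(\sum_c f c) (erefl (\sum_c f c)) => w.
elim: w f => [|w IHw] f fw.
  exists 0 => T chi l _; exists [::], (chi [::]); split; first exact: sub0seq.
    by move/eqP: fw; rewrite sum_nat_eq0 => /forallP/(_ (chi [::]))/eqP ->.
  by move=> u; rewrite subseq0 => /eqP ->.
have [/existsP[c /eqP fc0]|] := boolP [exists c, f c == 0].
  exists 0 => T chi l _; exists [::], c; split=> //; first exact: sub0seq.
  by move=> u; rewrite subseq0 => /eqP ->.
rewrite negb_exists => /forallP f_neq0.
pose dec c0 c := if c == c0 then (f c).-1 else f c.
have sum_dec c0 : \sum_c dec c0 c = w.
  apply/eqP; rewrite -eqSS -fw (bigD1 c0) //= [in X in _ == X](bigD1 c0) //=.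
  rewrite {1}/dec eqxx -addSn prednK ?lt0n ?f_neq0 // eqn_add2l.
  by apply/eqP/eq_bigr => c /negPf cc0; rewrite /dec cc0.
have [M MP] := fin_all_exists (fun c0 => IHw (dec c0) (sum_dec c0)).
have [N NP] := IHs (\max_c M c).
exists N.+1 => T chi [//|x l] /= Nl.
(* On [l1] every [x :: u] has colour [c0], so the target of [c0] may drop by one: if [c0] is the
   colour found, prepending [x] restores the length. *)
have [l1 [c0 [l1l sl1 l1P]]] := NP T (fun u => chi (x :: u)) l Nl.
have Ml1 : M c0 <= size l1 by rewrite sl1; apply: leq_bigmax.
have [l2 [c [l2l1 sl2 l2P]]] := MP c0 T chi l1 Ml1.
have l2l := subseq_trans l2l1 l1l.
have [c_c0|c_c0] := eqVneq c c0; last first.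
  exists l2, c; split=> //; last by rewrite sl2 /dec (negPf c_c0).
  exact: subseq_trans l2l (subseq_cons _ _).
subst c0; exists (x :: l2), c; split.
- by rewrite /= eqxx.
- by rewrite /= sl2 /dec eqxx prednK // lt0n f_neq0.
case=> [//|y u] /=; case: eqP => [-> ul2 [su]|_ yul2 su].
  by apply: l1P su; apply: subseq_trans ul2 l2l1.
exact: l2P.
Qed.

(** * Uniform families of interval systems *)

(** A union of half-open intervals [e 0, e 1), [e 2, e 3), ... is encoded by its endpoints: for [e]
    nondecreasing and [r] even, [t] belongs to it iff this number is odd. *)
Definition cnt (e : nat -> nat) r t := count (fun p => e p <= t) (iota 0 r).

(** The indices counted by [cnt] form an initial segment, because [e] is nondecreasing. *)
Lemma cnt_lt e r t p : {homo e : p q / p <= q} -> p < r ->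
  (e p <= t) = (p < cnt e r t).
Proof.
move=> e_mono; rewrite /cnt.
have full q : e q <= t -> count (fun p => e p <= t) (iota 0 q) = q.
  move=> eqt; rewrite (eq_in_count (a2 := xpredT)) ?count_predT ?size_iota //.
  move=> i; rewrite mem_iota /= => iq; exact: leq_trans (e_mono _ _ (ltnW iq)) eqt.
elim: r => // r IHr.
have -> : iota 0 r.+1 = iota 0 r ++ [:: r] by rewrite -addn1 iotaD.
rewrite ltnS leq_eqVlt count_cat /= addn0.
have sz := count_size (fun p => e p <= t) (iota 0 r); rewrite size_iota in sz.
case/predU1P => [->|pr]; first by have := full r; lia.
have := full r; have := IHr pr; lia.
Qed.

Lemma cnt_le e r t : cnt e r t <= r.
Proof. by rewrite -[leqRHS](size_iota 0 r) count_size. Qed.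

(* If t avoids both extreme sets but lies in two sets in between, then the
   endpoints adjacent to t move in contradictory directions. *)
Lemma islands r (g : nat -> nat -> nat) (P : pred nat) t b i0 i1 i2 i3 :
  (forall i, P i -> {homo g i : p q / p <= q}) ->
  (forall p q i j i' j', p < r -> q < r -> P i -> P j -> P i' -> P j' ->
    i < j -> i' < j' -> (g i p < g j q) = (g i' p < g j' q) /\
                        (g j q < g i p) = (g j' q < g i' p)) ->
  P i0 -> P i1 -> P i2 -> P i3 -> i0 < i1 < i2 -> i2 < i3 ->
  odd (cnt (g i0) r t) = b -> odd (cnt (g i3) r t) = b ->
  odd (cnt (g i1) r t) = ~~ b -> odd (cnt (g i2) r t) = ~~ b -> False.
Proof.
move=> mono H P0 P1 P2 P3 /andP[lt01 lt12] lt23 o0 o3 o1 o2.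
have lt02 := ltn_trans lt01 lt12; have lt13 := ltn_trans lt12 lt23.
have lt03 := ltn_trans lt01 lt13.
have K i p : P i -> p < r -> (g i p <= t) = (p < cnt (g i) r t).
  by move=> Pi pr; apply: cnt_lt => //; apply: mono.
have ne01 : cnt (g i0) r t <> cnt (g i1) r t by move=> E; move: o0; rewrite E o1; case: b {o1 o2 o3}.
have ne32 : cnt (g i3) r t <> cnt (g i2) r t by move=> E; move: o3; rewrite E o2; case: b {o1 o2 o0}.
move: (cnt_le (g i0) r t) (cnt_le (g i1) r t) (cnt_le (g i2) r t) (cnt_le (g i3) r t).
move: (K i0) (K i1) (K i2) (K i3) ne01 ne32.
set c0 := cnt (g i0) r t; set c1 := cnt (g i1) r t.
set c2 := cnt (g i2) r t; set c3 := cnt (g i3) r t.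
move=> /(_ _ P0) K0 /(_ _ P1) K1 /(_ _ P2) K2 /(_ _ P3) K3 ne01 ne32 l0 l1 l2 l3.
(* If [c1 < c0], the endpoint of index [c1] is at most [t] for [i0] and beyond [t] for [i1];
   otherwise the one of index [c1.-1] crosses [t] the other way. The same holds for [i3] and [i2].
   Uniformity carries the resulting inequalities over to the pair [i1 < i2]. *)
have [h01|h01] := ltnP c1 c0; have [h32|h32] := ltnP c2 c3.
- have c1r : c1 < r by lia.
  have c2r : c2 < r by lia.
  have [E1 _] := H c1 c1 i0 i1 i1 i2 c1r c1r P0 P1 P1 P2 lt01 lt12.
  have [_ E2] := H c2 c2 i2 i3 i1 i2 c2r c2r P2 P3 P1 P2 lt23 lt12.
  have := K0 _ c1r; have := K1 _ c1r; have := K2 _ c1r.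
  have := K3 _ c2r; have := K2 _ c2r; have := K1 _ c2r.
  rewrite h01 h32 !ltnn => k1 k2 k3 k2' k1' k0.
  have c12 : c1 = c2 by lia.
  by move: E1 E2; rewrite c12 in k1' k0 *; lia.
- have c1r : c1 < r by lia.
  have c2r : c2.-1 < r by lia.
  have [E1 _] := H c1 c2.-1 i0 i3 i1 i2 c1r c2r P0 P3 P1 P2 lt03 lt12.
  have := K0 _ c1r; have := K1 _ c1r; have := K2 _ c2r; have := K3 _ c2r; lia.
- have c1r : c1.-1 < r by lia.
  have c2r : c2 < r by lia.
  have [_ E1] := H c1.-1 c2 i0 i3 i1 i2 c1r c2r P0 P3 P1 P2 lt03 lt12.
  have := K0 _ c1r; have := K1 _ c1r; have := K2 _ c2r; have := K3 _ c2r; lia.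
- have c1r : c1.-1 < r by lia.
  have c2r : c2.-1 < r by lia.
  have [_ E1] := H c1.-1 c1.-1 i0 i1 i1 i2 c1r c1r P0 P1 P1 P2 lt01 lt12.
  have [E2 _] := H c2.-1 c2.-1 i2 i3 i1 i2 c2r c2r P2 P3 P1 P2 lt23 lt12.
  have := K0 _ c1r; have := K1 _ c1r; have := K2 _ c1r.
  have := K3 _ c2r; have := K2 _ c2r; have := K1 _ c2r.
  move=> k1' k2' k3' k3 k1 k0.
  have c1_gt0 : 0 < c1 by clear -h01 ne01; lia.
  have c2_gt0 : 0 < c2 by clear -h32 ne32; lia.
  have le12 : c1 <= c2 by clear -h01 ne01 c1_gt0 k0 k1 k3 E1; lia.
  have le21 : c2 <= c1 by clear -h32 ne32 c2_gt0 k1' k2' k3' E2; lia.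
  have c12 : c1 = c2 by apply/eqP; rewrite eqn_leq le12.
  rewrite c12 in E1 k0 k1; clear -h01 h32 ne01 ne32 c12 E1 E2 k0 k1 k1' k2' k3'; lia.
Qed.

(** If the intervals [c, d) start before the intervals [a, b), their first common point avoids the
    latter. Otherwise the given point of [c0, d0) outside [a0, b0) forces [b0 < d0], and the last
    common point works. *)
Lemma one_interval_star (a0 b0 a1 b1 c0 d0 c1 d1 : nat) :
  [/\ (c0 < a0) = (c0 < a1), (c0 < a0) = (c1 < a0) & (c0 < a0) = (c1 < a1)] ->
  [/\ (b0 < d0) = (b1 < d0), (b0 < d0) = (b0 < d1) & (b0 < d0) = (b1 < d1)] ->
  (exists t, c0 <= t < d0 /\ ~~ (a0 <= t < b0)) ->
  (exists t, c0 <= t < d0 /\ c1 <= t < d1) ->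
  exists t, [/\ c0 <= t < d0, c1 <= t < d1, ~~ (a0 <= t < b0) & ~~ (a1 <= t < b1)].
Proof.
move=> [h1 h2 h3] [h4 h5 h6] [t [t1 t2]] [s [s1 s2]].
have [ca|ac] := ltnP c0 a0.
  exists (maxn c0 c1); clear h4 h5 h6 t1 t2; split; lia.
exists (minn d0 d1).-1; clear h1 h2 h3; have : b0 < d0 by lia.
by clear t1 t2; split; lia.
Qed.

Definition two_intervals (e : nat -> nat) t := (e 0 <= t < e 1) || (e 2 <= t < e 3).

Definition strict4 (e : nat -> nat) := [&& e 0 < e 1, e 1 < e 2 & e 2 < e 3].

Lemma two_intervals_eq e t t' : (forall r, r < 4 -> (e r <= t) = (e r <= t')) ->
  two_intervals e t = two_intervals e t'.
Proof.
move=> H; have := H 0 isT; have := H 1 isT; have := H 2 isT; have := H 3 isT.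
rewrite /two_intervals; lia.
Qed.

(* The only uniform way for A0 and A1 to cover the intersection of F0 and F1,
   although no single A covers it and A0, A1 do not cover F0. *)
Lemma two_intervals_star (A0 A1 F0 F1 : nat -> nat) t s :
  let hom A F A' F' := forall r u, r < 4 -> u < 4 ->
    (A r < F u) = (A' r < F' u) /\ (F u < A r) = (F' u < A' r) in
  strict4 A0 -> strict4 A1 -> strict4 F0 -> strict4 F1 ->
  hom A0 F0 A0 F1 -> hom A0 F0 A1 F0 -> hom A0 F0 A1 F1 ->
  (forall t, two_intervals F0 t -> two_intervals F1 t ->
     two_intervals A0 t || two_intervals A1 t) ->
  [/\ two_intervals F0 t, ~~ two_intervals A0 t & ~~ two_intervals A1 t] ->
  [/\ two_intervals F0 s, two_intervals F1 s & ~~ two_intervals A0 s] ->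
  (A0 2 <= A1 1) || (A1 2 <= A0 1) /\
  ([/\ (F0 1 <= F1 0) || (F1 1 <= F0 0), F0 1 < A0 0, A0 0 <= F0 2 < A0 1 & A0 2 < F0 3 <= A0 3]
   \/ [/\ (F0 3 <= F1 2) || (F1 3 <= F0 2), A0 3 < F0 2, A0 0 <= F0 0 < A0 1 & A0 2 < F0 1 <= A0 3]).
Proof.
move=> hom sA0 sA1 sF0 sF1 h01 h10 h11 cov [tF0 tA0 tA1] [sF0' sF1' sA0'].
have strictp e p : strict4 e -> (p == 0) || (p == 2) -> e p < e p.+1.
  by move=> /and3P[? ? ?] /orP[] /eqP ->.
have inp e p u : (p == 0) || (p == 2) -> e p <= u < e p.+1 -> two_intervals e u.
  by move=> /orP[] /eqP -> uI; rewrite /two_intervals uI ?orbT.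
have [p p02 tp] : exists2 p, (p == 0) || (p == 2) & F0 p <= t < F0 p.+1.
  by case/orP: tF0 => ?; [exists 0|exists 2].
have p4 : p < 4 by case/orP: p02 => /eqP ->.
have p14 : p.+1 < 4 by case/orP: p02 => /eqP ->.
have tF1 : ~~ two_intervals F1 t.
  by apply/negP => /(cov _ tF0); rewrite (negPf tA0) (negPf tA1).
have ntp : (F1 p.+1 <= t) || (t < F1 p).
  by move: tF1; apply: contraR => nt; apply: inp p02 _; clear - nt; lia.
have sp0 := strictp _ _ sF0 p02; have sp1 := strictp _ _ sF1 p02.
(* The p-th interval of F0, F1 slides: the two copies are disjoint, and both
   lie in gaps of A0 and A1. *)
have [chain gap] : (F0 p.+1 <= F1 p) || (F1 p.+1 <= F0 p) /\
   forall F u, F = F0 \/ F = F1 -> F p <= u < F p.+1 ->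
    ~~ two_intervals A0 u /\ ~~ two_intervals A1 u.
  have key : (F0 p.+1 <= F1 p) || (F1 p.+1 <= F0 p).
    case/orP: ntp => ntp.
      (* No endpoint of [A0] or [A1] lies between [F1 p.+1] and [t], since it would compare
         differently with [F0 p.+1] and [F1 p.+1]. Hence the last point of this interval of [F1] is
         uncovered, like [t]. *)
      have tA t' : t' = (F1 p.+1).-1 -> ~~ two_intervals A0 t' /\ ~~ two_intervals A1 t'.
        move=> Et'; split.
          rewrite (two_intervals_eq (t' := t)) // => r r4.
          by have [] := h01 r p.+1 r4 p14; clear - tp ntp Et' sp1; lia.
        rewrite (two_intervals_eq (t' := t)) // => r r4.
        have [+ _] := h10 r p.+1 r4 p14; have [] := h11 r p.+1 r4 p14.
        by clear - tp ntp Et' sp1; lia.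
      have [n0 n1] := tA _ erefl.
      have i1 : two_intervals F1 (F1 p.+1).-1 by apply: inp p02 _; clear - sp1; lia.
      apply/orP; right; rewrite leqNgt; apply/negP => lt.
      have i0 : two_intervals F0 (F1 p.+1).-1.
        by apply: inp p02 _; clear - tp ntp sp1 lt; lia.
      by have := cov _ i0 i1; rewrite (negPf n0) (negPf n1).
    have tA t' : t' = F1 p -> ~~ two_intervals A0 t' /\ ~~ two_intervals A1 t'.
      move=> Et'; split.
        rewrite (two_intervals_eq (t' := t)) // => r r4.
        by have [] := h01 r p r4 p4; clear - tp ntp Et' sp1; lia.
      rewrite (two_intervals_eq (t' := t)) // => r r4.
      have [_ +] := h10 r p r4 p4; have [] := h11 r p r4 p4.
      by clear - tp ntp Et' sp1; lia.
    have [n0 n1] := tA _ erefl.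
    have i1 : two_intervals F1 (F1 p) by apply: inp p02 _; clear - sp1; lia.
    apply/orP; left; rewrite leqNgt; apply/negP => lt.
    have i0 : two_intervals F0 (F1 p) by apply: inp p02 _; clear - tp ntp lt; lia.
    by have := cov _ i0 i1; rewrite (negPf n0) (negPf n1).
  split=> // F u F01 uF.
  have tA A : A = A0 \/ A = A1 -> forall r, r < 4 -> (A r <= u) = (A r <= t).
    move=> A01 r r4; have [x1 x2] := h01 r p r4 p4; have [x3 x4] := h10 r p r4 p4.
    have [x5 x6] := h11 r p r4 p4; have [x1' x2'] := h01 r _ r4 p14.
    have [x3' x4'] := h10 r _ r4 p14; have [x5' x6'] := h11 r _ r4 p14.
    clear - A01 F01 uF ntp tp key x1 x2 x3 x4 x5 x6 x1' x2' x3' x4' x5' x6' sp0 sp1.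
    by case: A01 => ->; case: F01 uF => -> uF; case/orP: ntp => ntp; lia.
  by split; rewrite (two_intervals_eq (t' := t)) //; apply: tA; [left|right].
(* The point [s] lies in [A1], so it is not in the [p]-th intervals; it lies in the other interval
   of both [F0] and [F1], whose index is [q]. *)
have [q q02 Eq] : exists2 q, (q == 0) || (q == 2) & q = 2 - p.
  by exists (2 - p) => //; case/orP: p02 => /eqP ->.
have split_in e u : two_intervals e u -> (e p <= u < e p.+1) || (e q <= u < e q.+1).
  by rewrite Eq; case/orP: p02 => /eqP -> /orP[] ->; rewrite ?orbT.
have sA1' : two_intervals A1 s by have := cov _ sF0' sF1'; rewrite (negPf sA0').
have sq0 : F0 q <= s < F0 q.+1.
  case/orP: (split_in _ _ sF0') => // sp.
  by have [] := gap F0 s (or_introl erefl) sp; rewrite sA1'.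
have sq1 : F1 q <= s < F1 q.+1.
  case/orP: (split_in _ _ sF1') => // sp.
  by have [] := gap F1 s (or_intror erefl) sp; rewrite sA1'.
have q4 : q < 4 by case/orP: q02 => /eqP ->.
have q14 : q.+1 < 4 by case/orP: q02 => /eqP ->.
have [v v02 sv] : exists2 v, (v == 0) || (v == 2) & A1 v <= s < A1 v.+1.
  by case/orP: sA1' => ?; [exists 0|exists 2].
have v4 : v < 4 by case/orP: v02 => /eqP ->.
have v14 : v.+1 < 4 by case/orP: v02 => /eqP ->.
have nsv : (A0 v.+1 <= s) || (s < A0 v).
  by move: sA0'; apply: contraR => nt; apply: inp v02 _; clear - nt; lia.
have [chainA posA1 posA2] : [/\ (A0 2 <= A1 1) || (A1 2 <= A0 1), F0 q < A0 1 & A0 2 < F0 q.+1].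
  case/orP: nsv => nsv.
    (* The first point after the interval of [A1] around [s] is still in [F0] and [F1], but not in
       [A1]. So the second interval of [A0] covers it, which forces [v = 0] and [A0 2 <= A1 1]. *)
    have in_F t' : t' = A1 v.+1 -> two_intervals F0 t' /\ two_intervals F1 t'.
      move=> Et'; have [y1 y1'] := h10 v.+1 q.+1 v14 q14; have [y2 y2'] := h11 v.+1 q.+1 v14 q14.
      have [y3 y3'] := h01 v.+1 q.+1 v14 q14.
      by split; apply: inp q02 _; clear - sq0 sq1 y1 y2 y3 y1' y2' y3' nsv sv Et'; lia.
    have [i0 i1] := in_F _ erefl; have iA := cov _ i0 i1.
    have v0 : v = 0.
      case/orP: v02 => /eqP // Ev; move: iA sA0 sA1 nsv sv; rewrite Ev /two_intervals /strict4.
      clear; lia.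
    have [y1 y1'] := h10 1 q isT q4; have [y2 y2'] := h10 1 q.+1 isT q14.
    have [y3 y3'] := h10 2 q.+1 isT q14; rewrite v0 in iA nsv sv.
    move: iA sA0 sA1; rewrite /two_intervals /strict4 => iA sA0 sA1.
    clear - iA sA0 sA1 nsv sv sq0 sq1 y1 y1' y2 y2' y3 y3'.
    have : A0 2 <= A1 1 by lia.
    by split; lia.
  have in_F t' : t' = (A1 v).-1 -> two_intervals F0 t' /\ two_intervals F1 t'.
    move=> Et'; have [y1 y1'] := h10 v q v4 q4; have [y2 y2'] := h11 v q v4 q4.
    have [y3 y3'] := h01 v q v4 q4.
    by split; apply: inp q02 _; clear - sq0 sq1 y1 y2 y3 y1' y2' y3' nsv sv Et'; lia.
  have [i0 i1] := in_F _ erefl; have iA := cov _ i0 i1.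
  have A1v_gt0 : 0 < A1 v.
    have [y1 y1'] := h10 v q v4 q4; clear - sq0 nsv y1 y1'; lia.
  have v2 : v = 2.
    case/orP: v02 => /eqP // Ev; move: iA sA0 sA1 nsv sv A1v_gt0.
    rewrite Ev /two_intervals /strict4; clear; lia.
  have [y1 y1'] := h10 1 q isT q4; have [y2 y2'] := h10 2 q isT q4.
  have [y3 y3'] := h10 2 q.+1 isT q14; rewrite v2 in iA nsv sv A1v_gt0.
  move: iA sA0 sA1; rewrite /two_intervals /strict4 => iA sA0 sA1.
  clear - iA sA0 sA1 nsv sv sq0 sq1 y1 y1' y2 y2' y3 y3' A1v_gt0.
  have : A1 2 <= A0 1 by lia.
  by split; lia.
split=> //.
(* Both extreme points of the intersection of the [q]-th intervals must be covered. One precedes the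
   end of the first intervals of [A0] and [A1], the other follows the start of the second ones; this
   locates [A0 0] and [A0 3]. *)
have imax : two_intervals F0 (maxn (F0 q) (F1 q)) by apply: inp q02 _; clear - sq0 sq1; lia.
have imax' : two_intervals F1 (maxn (F0 q) (F1 q)) by apply: inp q02 _; clear - sq0 sq1; lia.
have imin : two_intervals F0 (minn (F0 q.+1) (F1 q.+1)).-1 by apply: inp q02 _; clear - sq0 sq1; lia.
have imin' : two_intervals F1 (minn (F0 q.+1) (F1 q.+1)).-1 by apply: inp q02 _; clear - sq0 sq1; lia.
have {imax imax'} jmax := cov _ imax imax'.
have {imin imin'} jmin := cov _ imin imin'.
have [le0 le3] : A0 0 <= F0 q /\ F0 q.+1 <= A0 3.
  have [x1 x1'] := h01 0 q isT q4; have [x2 x2'] := h10 0 q isT q4; have [x3 x3'] := h11 0 q isT q4.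
  have [y1 y1'] := h01 3 _ isT q14; have [y2 y2'] := h10 3 _ isT q14; have [y3 y3'] := h11 3 _ isT q14.
  have [z1 z1'] := h01 1 q isT q4; have [z2 z2'] := h10 1 q isT q4; have [z3 z3'] := h11 1 q isT q4.
  have [w1 w1'] := h01 2 _ isT q14; have [w2 w2'] := h10 2 _ isT q14; have [w3 w3'] := h11 2 _ isT q14.
  have a1 : maxn (F0 q) (F1 q) < A0 1 by clear - posA1 z1'; lia.
  have a2 : maxn (F0 q) (F1 q) < A1 1 by clear - posA1 z1' z2' z3'; lia.
  have b1 : A0 2 < minn (F0 q.+1) (F1 q.+1) by clear - posA2 w1; lia.
  have b2 : A1 2 < minn (F0 q.+1) (F1 q.+1) by clear - posA2 w1 w2 w3; lia.
  move: jmax jmin sA0 sA1; rewrite /two_intervals /strict4 => jmax jmin sA0 sA1.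
  split.
    by clear - jmax a1 a2 sA0 sA1 x1' x2' x3'; lia.
  by clear - jmin b1 b2 sA0 sA1 y1 y2 y3; lia.
have sp0' : ~~ two_intervals A0 (F0 p) /\ ~~ two_intervals A1 (F0 p).
  by apply: (gap F0); [left|rewrite leqnn].
have sp1' : ~~ two_intervals A0 (F1 p) /\ ~~ two_intervals A1 (F1 p).
  by apply: (gap F1); [right|rewrite leqnn].
have ep0' : ~~ two_intervals A0 (F0 p.+1).-1 /\ ~~ two_intervals A1 (F0 p.+1).-1.
  by apply: (gap F0); [left|clear - sp0; lia].
have ep1' : ~~ two_intervals A0 (F1 p.+1).-1 /\ ~~ two_intervals A1 (F1 p.+1).-1.
  by apply: (gap F1); [right|clear - sp1; lia].
have [z1 z1'] := h01 1 q isT q4; have [w1 w1'] := h01 2 _ isT q14.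
case/orP: p02 => /eqP Ep; subst p; rewrite Eq /= ?subn0 ?subnn in le0 le3 posA1 posA2 z1' w1.
  left; split; rewrite ?le0 ?posA2 //.
  (* Equality of [F0 1] and [A0 0] would give [F1 1 = A0 0] too, against the disjointness of the
     first intervals of [F0] and [F1]. *)
  have [x1 x1'] := h01 0 1 isT isT.
  move: ep0' ep1' sA0 sF0 sF1 => [+ _] [+ _]; rewrite /two_intervals /strict4.
  by clear - x1' chain posA1 z1' le0; lia.
right; split; rewrite ?le0 ?posA2 //.
have [x1 x1'] := h01 3 2 isT isT.
move: sp0' sp1' sA0 sF0 sF1 => [+ _] [+ _]; rewrite /two_intervals /strict4.
by clear - x1 chain posA2 w1 le3; lia.
Qed.

(** [A], [F], [G] belong to the pairs (i, j), (j, l), (i, l) of a triple, and the two inclusions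
    express transitivity. In the first case [F 1] is outside [A] and [F], hence outside [G], while
    [F 2] is in both, hence in [G]; the sliding conditions leave no room for this. The second case
    is its mirror image, with [A 3] and [(F 1).-1]. *)
Lemma two_intervals_triangle (A F G : nat -> nat) :
  strict4 A -> strict4 F -> strict4 G ->
  (forall t, two_intervals A t -> two_intervals F t -> two_intervals G t) ->
  (forall t, two_intervals G t -> two_intervals A t || two_intervals F t) ->
  (G 2 <= F 1) || (F 2 <= G 1) ->
  [/\ (A 1 <= G 0) || (G 1 <= A 0), F 1 < A 0, A 0 <= F 2 < A 1 & A 2 < F 3 <= A 3]
   \/ [/\ (A 3 <= G 2) || (G 3 <= A 2), A 3 < F 2, A 0 <= F 0 < A 1 & A 2 < F 1 <= A 3] ->
  False.
Proof.
move=> sA sF sG AFG GAF chainG [] [c1 c2 c3 c4].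
  have := AFG (F 2); have := GAF (F 1).
  by move: sA sF sG; rewrite /two_intervals /strict4; clear AFG GAF; lia.
have := AFG (F 1).-1; have := GAF (A 3).
by move: sA sF sG; rewrite /two_intervals /strict4; clear AFG GAF; lia.
Qed.

(** * Sequences of linear orders *)

Definition changes (I : nat -> bool) D := [seq t <- iota 1 D | I t != I t.-1].

(** Missing endpoints get the value [D.+1], past every change. This keeps the sequence nondecreasing
    and, after an even number of changes, adds only empty intervals. *)
Definition endpoint I D p := nth D.+1 (changes I D) p.

Lemma odd_size_changes I D : odd (size (changes I D)) = (I D != I 0).
Proof.
elim: D => [|D IHD]; first by rewrite eqxx.
rewrite /changes; have -> : iota 1 D.+1 = iota 1 D ++ [:: D.+1] by rewrite -[RHS](iotaD 1 D 1) addn1.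
rewrite filter_cat size_cat oddD -/(changes I D) IHD /=.
by case: (I D.+1); case: (I D); case: (I 0).
Qed.

Lemma changes_sorted I D : sorted ltn (changes I D).
Proof. exact: (sorted_filter ltn_trans) (iota_ltn_sorted _ _). Qed.

Lemma endpoint_lt I D p q : p < q -> p < size (changes I D) ->
  endpoint I D p < endpoint I D q.
Proof.
move=> pq ps; have [qs|sq] := ltnP q (size (changes I D)).
  by apply: (sorted_ltn_nth ltn_trans) => //; exact: changes_sorted.
rewrite /endpoint [X in _ < X]nth_default // ltnS.
have : nth D.+1 (changes I D) p \in iota 1 D.
  by apply: (@mem_subseq _ (changes I D)); [exact: filter_subseq|exact: mem_nth].
by rewrite mem_iota add1n ltnS => /andP[].
Qed.

Lemma endpoint_le I D : {homo endpoint I D : p q / p <= q}.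
Proof.
move=> p q; rewrite leq_eqVlt => /predU1P[->//|pq].
have [ps|sp] := ltnP p (size (changes I D)); first exact/ltnW/endpoint_lt.
by rewrite /endpoint !nth_default // (leq_trans sp (ltnW pq)).
Qed.

(** Every change flips [I], so the parity of the changes up to [t] decides [I t]. Past [D] the
    padding counts as well and the total is [r], which is even, in accordance with [I] being false
    there. *)
Lemma endpointP I D r t : I 0 = false -> (forall t, D <= t -> I t = false) ->
  size (changes I D) <= r -> ~~ odd r -> I t = odd (cnt (endpoint I D) r t).
Proof.
move=> I0 ID sr r_even.
have -> : cnt (endpoint I D) r t =
    count (fun e => e <= t) (changes I D ++ nseq (r - size (changes I D)) D.+1).
  rewrite /cnt -(count_map (endpoint I D) (fun e => e <= t)); congr count.
  apply: (@eq_from_nth _ D.+1); first by rewrite size_map size_iota size_cat size_nseq subnKC.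
  move=> i; rewrite size_map size_iota => ir.
  rewrite (nth_map 0) ?size_iota // nth_iota // add0n /endpoint nth_cat nth_nseq.
  by case: ltnP => // si; rewrite if_same nth_default.
rewrite count_cat count_nseq oddD oddM /=; have [tD|Dt] := leqP t D.
  rewrite /= addbF.
  have -> : count (fun e => e <= t) (changes I D) = size (changes I t).
    rewrite /changes -{1}(subnKC tD) iotaD filter_cat count_cat addnC.
    rewrite (eq_in_count (a2 := xpred0)) ?count_pred0 ?add0n; last first.
      by move=> e; rewrite mem_filter mem_iota => /andP[_ /andP[]] /=; lia.
    rewrite (eq_in_count (a2 := xpredT)) ?count_predT //.
    by move=> e; rewrite mem_filter mem_iota => /andP[_ /andP[]] /=; lia.
  by rewrite odd_size_changes I0; case: (I t).
rewrite (eq_in_count (a2 := xpredT)) ?count_predT; last first.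
  by move=> e; rewrite mem_filter mem_iota => /andP[_ /andP[]] /=; lia.
by rewrite /= oddB // (negPf r_even) odd_size_changes I0 !ID // ltnW.
Qed.

(* [up t x y] means that x is below y at time t. *)
Definition is_top T (up : nat -> rel T) (x : T) (u : seq T) t :=
  all (fun y => up t y x) u.

Definition convex_seq (T : eqType) (up : nat -> rel T) (u : seq T) :=
  forall x, x \in u -> exists t, is_top up x (rem x u) t.

Lemma is_topP (T : eqType) (up : nat -> rel T) (x : T) u t : uniq u ->
  reflect (forall y, y \in u -> y != x -> up t y x) (is_top up x (rem x u) t).
Proof.
move=> u_uniq; apply: (iffP allP) => H y.
  by move=> yu yx; apply: H; rewrite mem_rem_uniq // !inE yx.
by rewrite mem_rem_uniq // !inE => /andP[yx yu]; apply: H.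
Qed.

(** Completing [u] to [m] members of [s] only strengthens what a witness time must satisfy. *)
Lemma convex_seq_extend (T : eqType) (up : nat -> rel T) (s u : seq T) m :
  (forall v, uniq v -> {subset v <= s} -> size v = m -> convex_seq up v) ->
  uniq s -> m <= size s -> uniq u -> {subset u <= s} -> size u <= m -> convex_seq up u.
Proof.
move=> conv_m s_uniq ms u_uniq us um.
pose w := take (m - size u) [seq y <- s | y \notin u].
have w_sub y : y \in w -> y \in s /\ y \notin u.
  by move=> /mem_take; rewrite mem_filter => /andP[].
have sw : size w = m - size u.
  apply: size_takel; have := count_predC (mem u) s.
  have : count (mem u) s <= size u.
    rewrite -size_filter; apply: uniq_leq_size; first exact: filter_uniq.
    by move=> y; rewrite mem_filter => /andP[].
  rewrite size_filter /=; have -> : count (predC (mem u)) s = count (fun y => y \notin u) s by [].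
  lia.
have uw_uniq : uniq (u ++ w).
  rewrite cat_uniq u_uniq take_uniq ?filter_uniq // andbT.
  by apply/hasPn => y /w_sub[].
have uws : {subset u ++ w <= s}.
  by move=> y; rewrite mem_cat => /orP[/us|/w_sub[]].
have suw : size (u ++ w) = m by rewrite size_cat sw subnKC.
move=> x xu; have xuw : x \in u ++ w by rewrite mem_cat xu.
have [t] := conv_m _ uw_uniq uws suw _ xuw.
move=> /(is_topP _ _ _ uw_uniq) H; exists t; apply/is_topP => // y yu.
by apply: H; rewrite mem_cat yu.
Qed.

Lemma subseq_map_nth (T : eqType) (x0 : T) (l : seq T) (js : seq nat) :
  sorted ltn js -> all (fun j => j < size l) js -> subseq (map (nth x0 l) js) l.
Proof.
move=> js_sorted /allP js_lt; rewrite -{2}(mkseq_nth x0 l); apply: map_subseq.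
suff -> : js = [seq j <- iota 0 (size l) | j \in js] by exact: filter_subseq.
apply: (irr_sorted_eq ltn_trans ltnn) => //.
  exact: (sorted_filter ltn_trans) (iota_ltn_sorted _ _).
move=> j; rewrite mem_filter mem_iota /= add0n; apply/idP/andP => [jj|[]//].
by rewrite jj js_lt.
Qed.

(** Both strict inequalities are recorded, so the colour also detects equal endpoints. *)
Definition triple_color (T : Type) (e : T -> T -> nat -> nat) r (x0 : T) (u : seq T) :
    {ffun 'I_r * 'I_r -> (bool * bool) * (bool * bool) * (bool * bool)} :=
  let x := nth x0 u 0 in let y := nth x0 u 1 in let z := nth x0 u 2 in
  let cmp a b : bool * bool := (a < b, b < a) in
  [ffun pq => (cmp (e x y (val pq.1)) (e x z (val pq.2)),
               cmp (e x y (val pq.1)) (e y z (val pq.2)),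
               cmp (e x z (val pq.1)) (e y z (val pq.2)))].

Definition same_cmp (r : nat) (a b a' b' : nat -> nat) :=
  forall p q, p < r -> q < r ->
    (a p < b q) = (a' p < b' q) /\ (b q < a p) = (b' q < a' p).

Definition homogeneous (r Q : nat) (E : nat -> nat -> nat -> nat) :=
  forall i j l i' j' l', i < j < l -> l < Q -> i' < j' < l' -> l' < Q ->
  [/\ same_cmp r (E i j) (E i l) (E i' j') (E i' l'),
      same_cmp r (E i j) (E j l) (E i' j') (E j' l') &
      same_cmp r (E i l) (E j l) (E i' l') (E j' l')].

Lemma triple_color_homogeneous (T : eqType) e r (x0 : T) (l : seq T) c :
  (forall u, subseq u l -> size u = 3 -> triple_color e r x0 u = c) ->
  homogeneous r (size l) (fun i j => e (nth x0 l i) (nth x0 l j)).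
Proof.
move=> H i j h i' j' h' /andP[ij jh] hl /andP[ij' jh'] hl'.
have sub a b d : a < b -> b < d -> d < size l ->
    triple_color e r x0 [:: nth x0 l a; nth x0 l b; nth x0 l d] = c.
  move=> ab bd dl; apply: H => //; apply: (@subseq_map_nth _ x0 l [:: a; b; d]) => /=.
    by rewrite ab bd.
  by rewrite dl (ltn_trans bd dl) (ltn_trans ab (ltn_trans bd dl)).
have E := etrans (sub _ _ _ ij jh hl) (esym (sub _ _ _ ij' jh' hl')).
by split=> p q pr qr; have /ffunP/(_ (Ordinal pr, Ordinal qr)) := E;
  rewrite !ffunE /=; case=> *; split.
Qed.

(** * Uniform systems around a middle member *)

Section Middle.
Variables (r Q : nat) (E : nat -> nat -> nat -> nat).
Hypotheses (homE : homogeneous r Q E)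
  (monoE : forall i j, {homo E i j : p q / p <= q}).

Let inv i j t := odd (cnt (E i j) r t).

(** This is [islands] for the sets [E i x]: any [i < j < x] is a triple, whose colour compares
    [E i x] with [E j x]. *)
Lemma below_at_most_one x t i0 i1 i2 i3 : x < Q -> i0 < i1 < i2 -> i2 < i3 < x ->
  ~~ inv i0 x t -> ~~ inv i3 x t -> inv i1 x t -> inv i2 x t -> False.
Proof.
move=> xQ i012 /andP[i23 i3x] /negPf n0 /negPf n3 n1 n2.
have [i01 i12] := andP i012.
apply: (@islands r (fun i => E i x) (fun i => i < x) t false i0 i1 i2 i3) => //; try by lia.
move=> p q i j i' j' pr qr _ jx _ j'x ij ij'.
have ijx : i < j < x by rewrite ij.
have ijx' : i' < j' < x by rewrite ij'.
by have [_ _ /(_ p q pr qr)] := homE ijx xQ ijx' xQ.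
Qed.

Lemma above_at_most_one x t i0 i1 i2 i3 : i3 < Q -> x < i0 -> i0 < i1 < i2 -> i2 < i3 ->
  inv x i0 t -> inv x i3 t -> ~~ inv x i1 t -> ~~ inv x i2 t -> False.
Proof.
move=> i3Q xi0 i012 i23 n0 n3 /negPf n1 /negPf n2.
have [i01 i12] := andP i012.
apply: (@islands r (fun i => E x i) (fun i => x < i < Q) t true i0 i1 i2 i3) => //; try by lia.
move=> p q i j i' j' pr qr /andP[xi _] /andP[_ jQ] /andP[xi' _] /andP[_ jQ'] ij ij'.
have xij : x < i < j by rewrite xi.
have xij' : x < i' < j' by rewrite xi'.
by have [/(_ p q pr qr)] := homE xij jQ xij' jQ'.
Qed.

End Middle.

Section Core.
Variables (r n a : nat) (up : nat -> rel nat) (E : nat -> nat -> nat -> nat).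
Let Q := 6 * n + 6.
Hypotheses (homE : homogeneous r Q E)
  (monoE : forall i j, {homo E i j : p q / p <= q})
  (upE : forall i j t, i < j -> j < Q -> up t j i = odd (cnt (E i j) r t))
  (up_asym : forall t i j, i < Q -> j < Q -> i != j -> up t i j = ~~ up t j i)
  (up_trans : forall t, transitive (up t))
  (a_lt_n : a < n)
  (not_top : forall js, sorted ltn js -> all (ltn^~ Q) js -> size js = n ->
     forall t, ~~ is_top up (nth 0 js a) (rem (nth 0 js a) js) t).

(** The indices are laid out as [i0], three blocks of length [n], [i1], [x], [j0], three more blocks
    of length [n], and [j1]; all fit below [Q]. *)
Let x := 3 * n + 2.
Let i0 := 0.
Let i1 := 3 * n + 1.
Let j0 := 3 * n + 3.
Let j1 := 6 * n + 4.

Lemma middle_covered t : [|| up t x i0, up t x i1, ~~ up t j0 x | ~~ up t j1 x].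
Proof.
apply/negP => /negP; rewrite !negb_or !negbK => /and4P[ni0 ni1 nj0 nj1].
have upE' := fun i j => @upE i j t.
rewrite !upE' in ni0 ni1 nj0 nj1; try by rewrite /Q /x /i0 /i1 /j0 /j1; lia.
(* The [v]-th tuple takes [a] members from the [v]-th lower block and [n - 1 - a] from the [v]-th
   upper one, so [x] has rank [a] in it and is not on top. *)
have cover v : v < 3 -> (exists2 i, 1 + v * n <= i < 1 + v * n + a & odd (cnt (E i x) r t)) \/
   (exists2 j, 3 * n + 4 + v * n <= j < 3 * n + 4 + v * n + (n - 1 - a) & ~~ odd (cnt (E x j) r t)).
  move=> v3; pose js := iota (1 + v * n) a ++ x :: iota (3 * n + 4 + v * n) (n - 1 - a).
  have vn : v * n <= 2 * n by rewrite leq_mul2r; lia.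
  have js_uniq_sorted : sorted ltn js.
    rewrite (sorted_pairwise ltn_trans) pairwise_cat /= -!(sorted_pairwise ltn_trans).
    rewrite !iota_ltn_sorted /= !andbT; apply/andP; split.
      by apply/allrelP => i j; rewrite inE !mem_iota /x; clear - vn a_lt_n; lia.
    by apply/allP => j; rewrite mem_iota /x; clear; lia.
  have js_nth : nth 0 js a = x by rewrite /js nth_cat size_iota ltnn subnn.
  have js_size : size js = n by rewrite size_cat /= !size_iota; lia.
  have js_Q : all (ltn^~ Q) js.
    by apply/allP => j; rewrite mem_cat inE !mem_iota /Q /x /=; clear - vn a_lt_n; lia.
  have js_uniq : uniq js by exact: sorted_uniq ltn_trans ltnn _ js_uniq_sorted.
  have := not_top js_uniq_sorted js_Q js_size t; rewrite js_nth => /allPn[y].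
  rewrite mem_rem_uniq // !inE mem_cat inE !mem_iota => /andP[yx].
  rewrite (negPf yx) orFb => yI nup; case/orP: yI => yI; [left|right]; exists y => //.
    rewrite -upE'; [|rewrite /x; lia|rewrite /x /Q; lia].
    by rewrite up_asym // 1?eq_sym // /x /Q; lia.
  rewrite -upE' //; rewrite /x /Q; lia.
have A v v' i i' : v < v' -> v' < 3 -> 1 + v * n <= i < 1 + v * n + a ->
    1 + v' * n <= i' < 1 + v' * n + a ->
    odd (cnt (E i x) r t) -> odd (cnt (E i' x) r t) -> False.
  move=> vv' v3 iI iI' o o'.
  have vn : v.+1 * n <= v' * n by rewrite leq_mul2r vv' orbT.
  have vn' : v' * n <= 2 * n by rewrite leq_mul2r; lia.
  apply: (@below_at_most_one r Q E homE monoE x t i0 i i' i1) => //;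
    by rewrite /x /Q /i0 /i1; lia.
have B v v' i i' : v < v' -> v' < 3 -> 3 * n + 4 + v * n <= i < 3 * n + 4 + v * n + (n - 1 - a) ->
    3 * n + 4 + v' * n <= i' < 3 * n + 4 + v' * n + (n - 1 - a) ->
    ~~ odd (cnt (E x i) r t) -> ~~ odd (cnt (E x i') r t) -> False.
  move=> vv' v3 iI iI' o o'.
  have vn : v.+1 * n <= v' * n by rewrite leq_mul2r vv' orbT.
  have vn' : v' * n <= 2 * n by rewrite leq_mul2r; lia.
  apply: (@above_at_most_one r Q E homE monoE x t j0 i i' j1) => //;
    by rewrite /x /Q /j0 /j1; lia.
(* Two of the three tuples cover [x] from the same side, by members of different blocks. *)
have [[u u1 u2]|[u u1 u2]] := cover 0 isT; have [[v v1 v2]|[v v1 v2]] := cover 1 isT;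
  have [[w w1 w2]|[w w1 w2]] := cover 2 isT.
all: first [exact: (A 0 1 u v) | exact: (A 0 2 u w) | exact: (A 1 2 v w)
  | exact: (B 0 1 u v) | exact: (B 0 2 u w) | exact: (B 1 2 v w)].
Qed.

Let lt_i0x : i0 < x. Proof. by rewrite /i0 /x; lia. Qed.
Let lt_i1x : i1 < x. Proof. by rewrite /i1 /x; lia. Qed.
Let lt_i01 : i0 < i1. Proof. by rewrite /i0 /i1; lia. Qed.
Let lt_xj0 : x < j0. Proof. by rewrite /j0 /x; lia. Qed.
Let lt_xj1 : x < j1. Proof. by rewrite /j1 /x; lia. Qed.
Let lt_j01 : j0 < j1. Proof. by rewrite /j0 /j1; lia. Qed.
Let lt_j1Q : j1 < Q. Proof. by rewrite /j1 /Q; lia. Qed.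

Let up_xi t i : i < x -> up t x i = ~~ up t i x.
Proof. by move=> ix; apply: up_asym; rewrite /Q; lia. Qed.

Lemma middle_not_top t : up t i0 x -> up t i1 x -> up t j0 x -> up t j1 x -> False.
Proof.
move=> n0 n1 n2 n3; have := middle_covered t.
by rewrite !up_xi // n0 n1 n2 n3.
Qed.

Lemma top_middle us : uniq us -> x \in us -> convex_seq up us ->
  exists t, forall y, y \in us -> y != x -> up t y x.
Proof.
by move=> us_uniq xus /(_ x xus)[t /(is_topP _ _ _ us_uniq) top_x]; exists t.
Qed.

Lemma not_convex5 : ~ convex_seq up [:: i0; i1; x; j0; j1].
Proof.
move=> /top_middle[||t top_x]; rewrite /= ?inE; try lia.
by apply: (@middle_not_top t); apply: top_x; rewrite ?inE; lia.
Qed.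

(** The triples give a time in [E x j0] outside [E i0 x] and a time common to [E x j0] and [E x j1].
    By [one_interval_star] there is then a time when [x] is above all four extreme members, against
    [middle_covered]. *)
Lemma not_convex3 : 1 < r ->
  (forall i j t, i < j -> j < Q -> up t j i = (E i j 0 <= t < E i j 1)) ->
  convex_seq up [:: i0; x; j0] -> convex_seq up [:: x; j0; j1] -> False.
Proof.
move=> r1 upI conv1 conv2.
have r0 : 0 < r by exact: ltnW.
have lt_j0Q := ltn_trans lt_j01 lt_j1Q.
have lt_xQ := ltn_trans lt_xj0 lt_j0Q.
have hom i j p : p < r -> i < x -> x < j -> j < Q ->
    (E i0 x p < E x j0 p) = (E i x p < E x j p) /\ (E x j0 p < E i0 x p) = (E x j p < E i x p).
  move=> pr ix xj jQ.
  have l1 : i0 < x < j0 by rewrite lt_i0x.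
  have l2 : i < x < j by rewrite ix.
  by have [_ /(_ p p pr pr)] := homE l1 lt_j0Q l2 jQ.
have [] := @one_interval_star (E i0 x 0) (E i0 x 1) (E i1 x 0) (E i1 x 1)
  (E x j0 0) (E x j0 1) (E x j1 0) (E x j1 1).
- split; [have [] := hom i1 j0 0 r0 | have [] := hom i0 j1 0 r0 | have [] := hom i1 j1 0 r0] => //.
- split; [have [] := hom i1 j0 1 r1 | have [] := hom i0 j1 1 r1 | have [] := hom i1 j1 1 r1] => //.
- have [||t top_x] := top_middle _ _ conv1; rewrite /= ?inE; try lia.
  exists t; rewrite -!upI // up_xi // negbK.
  by split; apply: top_x; rewrite ?inE; lia.
- have [||t top_x] := top_middle _ _ conv2; rewrite /= ?inE; try lia.
  exists t; rewrite -!upI //.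
  by split; apply: top_x; rewrite ?inE; lia.
move=> t; rewrite -!upI //.
rewrite !up_xi // !negbK => -[u1 u2 u3 u4].
exact: (@middle_not_top t).
Qed.

Lemma cnt4 e t : {homo e : p q / p <= q} -> odd (cnt e 4 t) = two_intervals e t.
Proof.
move=> e_mono; have := e_mono 0 1 isT; have := e_mono 1 2 isT; have := e_mono 2 3 isT.
by rewrite /cnt /two_intervals /=; clear; lia.
Qed.

(** The covering hypothesis of [two_intervals_star] is [middle_covered], and the two quadruples
    supply its points [t] and [s]. Uniformity then carries the sliding found there to the triple
    [i0 < x < j0]. *)
Lemma not_convex4 : r = 4 -> (forall i j, i < j -> j < Q -> strict4 (E i j)) ->
  convex_seq up [:: i0; i1; x; j0] -> convex_seq up [:: i0; x; j0; j1] -> False.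
Proof.
move=> r4 strictE conv1 conv2.
have lt_j0Q := ltn_trans lt_j01 lt_j1Q.
have lt_xQ := ltn_trans lt_xj0 lt_j0Q.
have up2 i j t : i < j -> j < Q -> up t j i = two_intervals (E i j) t.
  by move=> ij jQ; rewrite upE // r4 cnt4.
have l1 : i0 < x < j0 by rewrite lt_i0x.
have hom i j : i < x -> x < j -> j < Q -> same_cmp 4 (E i0 x) (E x j0) (E i x) (E x j).
  move=> ix xj jQ; have l2 : i < x < j by rewrite ix.
  by rewrite -r4; have [] := homE l1 lt_j0Q l2 jQ.
have [||t top_t] := top_middle _ _ conv1; rewrite /= ?inE; try lia.
have [||s top_s] := top_middle _ _ conv2; rewrite /= ?inE; try lia.
have [||||||||||chainA pos] := @two_intervals_star (E i0 x) (E i1 x) (E x j0) (E x j1) t s.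
- exact: strictE.
- exact: strictE.
- exact: strictE.
- exact: strictE.
- exact: hom.
- exact: hom.
- exact: hom.
- move=> u; rewrite -!up2 //; try lia.
  by have := middle_covered u; case: (up u j0 x) => //; case: (up u j1 x); rewrite ?orbF.
- rewrite -!up2 // !up_xi // !negbK.
  by split; apply: top_t; rewrite ?inE; lia.
- rewrite -!up2 // ?up_xi // ?negbK; try lia.
  by split; apply: top_s; rewrite ?inE; lia.
have l3 : x < j0 < j1 by rewrite lt_xj0.
have l4 : i0 < i1 < x by rewrite lt_i01.
have lt_i0j0 : i0 < j0 by lia.
apply: (@two_intervals_triangle (E i0 x) (E x j0) (E i0 j0)); try exact: strictE.
- move=> u; rewrite -!up2 // => a1 a2; exact: up_trans a2 a1.
- move=> u; rewrite -!up2 //; case: (boolP (up u j0 x)); rewrite ?orbT // orbF => n0 u0.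
  apply: up_trans u0; rewrite up_asym //; lia.
(* Sliding between pairs with the common later member [x] becomes sliding between pairs with the
   common later member [j0]. *)
- have [_ _] := homE l4 lt_xQ l1 lt_j0Q; rewrite r4 => H; move: chainA.
  rewrite (leqNgt (E i0 x 2)) (leqNgt (E i1 x 2)) (leqNgt (E i0 j0 2)) (leqNgt (E x j0 2)).
  by have [_ ->] := H 2 1 isT isT; have [-> _] := H 1 2 isT isT.
(* Likewise for a common earlier member: the triple [x < j0 < j1] is replaced by [i0 < x < j0]. *)
have [H _ _] := homE l3 lt_j1Q l1 lt_j0Q; rewrite r4 in H.
case: pos => -[c p1 p2 p3]; [left|right]; split=> //; move: c.
  rewrite (leqNgt (E x j0 1)) (leqNgt (E x j1 1)) (leqNgt (E i0 x 1)) (leqNgt (E i0 j0 1)).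
  by have [_ ->] := H 1 0 isT isT; have [-> _] := H 0 1 isT isT.
rewrite (leqNgt (E x j0 3)) (leqNgt (E x j1 3)) (leqNgt (E i0 x 3)) (leqNgt (E i0 j0 3)).
by have [_ ->] := H 3 2 isT isT; have [-> _] := H 2 3 isT isT.
Qed.

End Core.

(** * Reduction of sequences of orders to uniform systems *)

Lemma cnt2 e t : {homo e : p q / p <= q} -> odd (cnt e 2 t) = (e 0 <= t < e 1).
Proof. by move=> e_mono; have := e_mono 0 1 isT; rewrite /cnt /=; clear; lia. Qed.

Lemma m_ge3 k : 2 < m_ k.
Proof. by case: k => [|[|[|]]]. Qed.

Lemma m_le5 k : m_ k <= 5.
Proof. by case: k => [|[|[|]]]. Qed.

Theorem convex_subfamily k n : 0 < k -> exists N, forall (T : eqType) (up : nat -> rel T) (s : seq T) D,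
  uniq s -> N <= size s ->
  (forall t, transitive (up t)) ->
  (forall t, {in s &, forall x y, x != y -> up t x y = ~~ up t y x}) ->
  (forall t, D <= t -> up t = up 0) ->
  {in s &, forall x y, x != y -> size (changes (fun t => up t x y) D) <= 2 * k} ->
  (forall u, uniq u -> {subset u <= s} -> size u = m_ k -> convex_seq up u) ->
  exists u, [/\ uniq u, {subset u <= s}, size u = n & convex_seq up u].
Proof.
move=> k_gt0; pose Q := 6 * n + 6; pose r := 2 * k.
(* The bounds are obtained in reverse: pairs are made uniform first, then triples, then [n]-tuples,
   which leaves [Q] members. *)
have [N1 N1P] := ramsey 'I_n.+1 n Q.
have [N2 N2P] := ramsey {ffun 'I_r * 'I_r -> (bool * bool) * (bool * bool) * (bool * bool)} 3 N1.
have [N3 N3P] := ramsey bool 2 N2.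
(* The bound 5 leaves room to complete smaller tuples to [m_ k] members. *)
exists (maxn 5 N3) => T up s D s_uniq; rewrite geq_max => /andP[s5 sN3].
move=> up_trans up_asym up_late up_changes conv_m.
have [//|nex] := pselect (exists u, [/\ uniq u, {subset u <= s}, size u = n & convex_seq up u]).
exfalso.
(* Numbering by the initial order keeps time 0 out of every set [I(i, j)]. *)
pose leT x y := (x == y) || up 0 x y.
have leT_trans : transitive leT.
  move=> y x z /orP[/eqP->//|xy] /orP[/eqP<-|yz]; apply/orP; right=> //.
  exact: up_trans xy yz.
have leT_total : {in s &, total leT}.
  move=> x y xs ys; rewrite /leT eq_sym; case: eqVneq => //= yx.
  by rewrite up_asym // 1?eq_sym //; case: (up 0 y x).
have x0 : T by case: (s) s5.
pose s' := sort leT s.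
have s'N3 : N3 <= size s' by rewrite size_sort.
have s'_sorted : sorted leT s' by exact: (sort_sorted_in leT_total) (allss s).
have s'_uniq : uniq s' by rewrite sort_uniq.
have [l1 [b [l1s sl1 l1P]]] := N3P T
  (fun u => size (changes (fun t => up t (nth x0 u 1) (nth x0 u 0)) D) <= 2) s' s'N3.
pose e x y := endpoint (fun t => up t y x) D.
have [l2 [c3 [l2s sl2 l2P]]] := N2P T (triple_color e r x0) l1 (eq_leq (esym sl1)).
pose dominated u x := `[< ~ exists t, is_top up x (rem x u) t >].
(* The colour of an [n]-tuple is the rank of its first member that is never on top; the value [n]
   means that there is none. *)
have [l3 [a [l3s sl3 l3P]]] := N1P T (fun u => inord (find (dominated u) u)) l2 (eq_leq (esym sl2)).
have l31 := subseq_trans l3s l2s.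
have l3s' := subseq_trans l31 l1s.
have l3_uniq : uniq l3 by exact: subseq_uniq s'_uniq.
have l3_sorted : sorted leT l3 by exact: subseq_sorted leT_trans _ _ l3s' s'_sorted.
have l3_sub : {subset l3 <= s} by move=> y /(mem_subseq l3s'); rewrite mem_sort.
pose X j := nth x0 l3 j.
pose upX t i j := up t (X i) (X j).
pose E i j := e (X i) (X j).
have Xs j : j < Q -> X j \in s by rewrite -sl3 => jQ; apply/l3_sub/mem_nth.
have X_inj i j : i < Q -> j < Q -> (X i == X j) = (i == j).
  by rewrite -sl3 => iQ jQ; rewrite nth_uniq.
have up0X i j : i < j -> j < Q -> up 0 (X i) (X j).
  move=> ij jQ; have iQ := ltn_trans ij jQ.
  have /orP[/eqP/eqP|//] : leT (X i) (X j).
    apply: (sorted_leq_nth leT_trans _ x0 l3_sorted); rewrite ?inE ?sl3 //; last exact: ltnW.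
    by move=> y; rewrite /leT eqxx.
  by rewrite X_inj // ltn_eqF.
have homE : homogeneous r Q E.
  rewrite -sl3; apply: (@triple_color_homogeneous _ e r x0 l3 c3) => u ul3 su.
  by apply: l2P => //; exact: subseq_trans ul3 l3s.
have monoE i j : {homo E i j : p q / p <= q} by exact: endpoint_le.
have upX_asym t i j : i < Q -> j < Q -> i != j -> upX t i j = ~~ upX t j i.
  by move=> iQ jQ ij; apply: up_asym; rewrite ?Xs // X_inj.
have up0X' i j : i < j -> j < Q -> upX 0 j i = false.
  move=> ij jQ; rewrite upX_asym ?gtn_eqF // ?[upX _ _ _]up0X //; exact: ltn_trans ij jQ.
have upE r' i j t : i < j -> j < Q -> ~~ odd r' ->
    size (changes (fun t => upX t j i) D) <= r' -> upX t j i = odd (cnt (E i j) r' t).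
  move=> ij jQ r'_even sr; apply: (@endpointP (fun u => upX u j i)) => //; first exact: up0X'.
  by move=> u uD; rewrite /upX up_late //; exact: up0X'.
have changesX i j : i < j -> j < Q -> size (changes (fun t => upX t j i) D) <= r.
  move=> ij jQ; apply: up_changes; rewrite ?Xs ?X_inj ?gtn_eqF //; exact: ltn_trans ij jQ.
have r_even : ~~ odd r by rewrite oddM.
have upEr i j t : i < j -> j < Q -> upX t j i = odd (cnt (E i j) r t).
  by move=> ij jQ; apply: upE => //; exact: changesX.
have upX_trans t : transitive (upX t) by move=> j i l; exact: up_trans.
have map_uniq js : uniq js -> all (ltn^~ Q) js -> uniq (map X js).
  move=> js_uniq /allP js_Q; rewrite map_inj_in_uniq // => i j /js_Q iQ /js_Q jQ /eqP.
  by rewrite X_inj // => /eqP.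
have map_sub js : all (ltn^~ Q) js -> {subset map X js <= s}.
  by move=> /allP js_Q _ /mapP[j /js_Q jQ ->]; exact: Xs.
have top_map js j t : uniq js -> all (ltn^~ Q) js -> j \in js ->
    is_top upX j (rem j js) t = is_top up (X j) (rem (X j) (map X js)) t.
  move=> js_uniq js_Q jjs; have jQ := allP js_Q _ jjs.
  have Xjs_uniq := map_uniq _ js_uniq js_Q.
  apply/(is_topP _ _ _ js_uniq)/(is_topP _ _ _ Xjs_uniq) => [H _ /mapP[i ijs ->]|H i ijs ij].
    by have iQ := allP js_Q _ ijs; rewrite X_inj // => /(H _ ijs).
  have iQ := allP js_Q _ ijs.
  by apply: H; rewrite ?map_f // X_inj.
have convX js : uniq js -> all (ltn^~ Q) js -> size js <= m_ k -> convex_seq upX js.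
  move=> js_uniq js_Q js_m j jjs.
  have [||||||t] := @convex_seq_extend _ up s (map X js) (m_ k) conv_m _ _ _ _ _ (X j).
  - by [].
  - exact: leq_trans (m_le5 k) s5.
  - exact: map_uniq.
  - exact: map_sub.
  - by rewrite size_map.
  - exact: map_f.
  by rewrite -top_map // => ?; exists t.
have a_find js : sorted ltn js -> all (ltn^~ Q) js -> size js = n ->
    a < n /\ forall t, ~~ is_top upX (nth 0 js a) (rem (nth 0 js a) js) t.
  move=> js_sorted js_Q js_n.
  have js_uniq : uniq js by exact: sorted_uniq ltn_trans ltnn _ js_sorted.
  have has_dom : has (dominated (map X js)) (map X js).
    apply/negP => /negP/hasPn no_dom; apply: nex; exists (map X js).
    rewrite size_map; split=> // [||y yjs]; [exact: map_uniq|exact: map_sub|].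
    by apply: contrapT => ny; move: (no_dom y yjs) => /negP; apply; apply/asboolP.
  have find_n : find (dominated (map X js)) (map X js) < n.
    by rewrite -[X in _ < X]js_n -(size_map X) -has_find.
  have a_eq : find (dominated (map X js)) (map X js) = a :> nat.
    have sub_l3 : subseq (map X js) l3 by apply: subseq_map_nth => //; rewrite sl3.
    have su : size (map X js) = n by rewrite size_map.
    by rewrite -(l3P _ sub_l3 su) inordK // ltnS ltnW.
  have a_lt_n : a < n by rewrite -a_eq.
  split=> // t; have := nth_find x0 has_dom; rewrite a_eq.
  rewrite (nth_map 0) ?js_n // => /asboolP no_top.
  by apply/negP => top_a; apply: no_top; exists t; rewrite -top_map // mem_nth ?js_n.
have iotaQ : all (ltn^~ Q) (iota 0 n) by apply/allP => j; rewrite mem_iota /Q /=; clear; lia.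
have [a_lt_n _] := a_find (iota 0 n) (iota_ltn_sorted _ _) iotaQ (size_iota _ _).
have not_top js h1 h2 h3 := (a_find js h1 h2 h3).2.
(* With at most two changes per pair each [I(i, j)] is a single interval, and convex triples give
   the contradiction for every [k]. *)
have small : (forall i j, i < j -> j < Q -> size (changes (fun t => upX t j i) D) <= 2) -> False.
  move=> le2; have r_gt1 : 1 < r by rewrite /r; clear -k_gt0; lia.
  apply: (not_convex3 homE monoE upEr upX_asym a_lt_n not_top r_gt1).
  - by move=> i j t ij jQ; rewrite (upE 2) ?cnt2 ?le2.
  - apply: convX; [rewrite /= !inE|rewrite /= /Q|exact: m_ge3]; clear; lia.
  - apply: convX; [rewrite /= !inE|rewrite /= /Q|exact: m_ge3]; clear; lia.
have pairs i j : i < j -> j < Q -> (size (changes (fun t => upX t j i) D) <= 2) = b.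
  move=> ij jQ; rewrite -(l1P [:: X i; X j]) //; apply: subseq_trans l31.
  by apply: (@subseq_map_nth _ x0 l3 [:: i; j]); rewrite /= ?ij // sl3 jQ (ltn_trans ij).
have [k3|] := ltnP 2 k.
  have mk : m_ k = 5 by case: (k) k3 => [|[|[|]]].
  apply: (not_convex5 homE monoE upEr upX_asym a_lt_n not_top).
  by apply: convX; [rewrite /= !inE|rewrite /= /Q|by rewrite mk]; clear -a_lt_n; lia.
rewrite leq_eqVlt => /predU1P[k2|k1]; last first.
  apply: small => i j ij jQ; apply: leq_trans (changesX _ _ ij jQ) _.
  by rewrite /r; clear -k1; lia.
have b_case : b = true \/ b = false by case: b {l1P pairs}; [left|right].
(* For [k = 2], either all pairs change at most twice, or all change more often and the four
   endpoints are distinct. *)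
case: b_case pairs => -> pairs; first by apply: small => i j ij jQ; rewrite pairs.
have mk : m_ k = 4 by rewrite k2.
have r4 : r = 4 by rewrite /r k2.
apply: (not_convex4 homE monoE upEr upX_asym upX_trans a_lt_n not_top r4).
- move=> i j ij jQ; have := pairs i j ij jQ; rewrite leqNgt => /negbFE sz.
  by apply/and3P; split; apply: endpoint_lt => //; exact: leq_trans sz.
- by apply: convX; [rewrite /= !inE|rewrite /= /Q|by rewrite mk]; clear -a_lt_n; lia.
- by apply: convX; [rewrite /= !inE|rewrite /= /Q|by rewrite mk]; clear -a_lt_n; lia.
Qed.

(** * Support functions *)

Import Order.TTheory GRing.Theory Num.Theory.
Import numFieldNormedType.Exports.
Local Open Scope classical_set_scope.
Local Open Scope card_scope.
Local Open Scope ring_scope.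

Section ConvexBodies.
Variable R : realType.
Implicit Types (u v p q theta : 'rV[R]_2) (K : set 'rV[R]_2).

Lemma dotE u v : dot u v = u ord0 ord0 * v ord0 ord0 + u ord0 (lift ord0 ord0) * v ord0 (lift ord0 ord0).
Proof. by rewrite /dot !big_ord_recl big_ord0 addr0. Qed.

Lemma dotC u v : dot u v = dot v u.
Proof. by rewrite !dotE ![u _ _ * _]mulrC. Qed.

Lemma dotDl u v w : dot (u + v) w = dot u w + dot v w.
Proof. by rewrite !dotE !mxE; ring. Qed.

Lemma dotZl c u v : dot (c *: u) v = c * dot u v.
Proof. by rewrite !dotE !mxE; ring. Qed.

Lemma dotDr u v w : dot w (u + v) = dot w u + dot w v.
Proof. by rewrite !dotE !mxE; ring. Qed.

Lemma dotZr c u v : dot v (c *: u) = c * dot v u.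
Proof. by rewrite !dotE !mxE; ring. Qed.

Lemma dotNl u v : dot (- u) v = - dot u v.
Proof. by rewrite !dotE !mxE; ring. Qed.

Lemma dot_gt0 u : u != 0 -> 0 < dot u u.
Proof.
move=> u0; rewrite lt_neqAle eq_sym; apply/andP; split; last first.
  by rewrite dotE addr_ge0 // -expr2 sqr_ge0.
apply: contra u0; rewrite dotE -!expr2 paddr_eq0 ?sqr_ge0 // !sqrf_eq0.
move=> /andP[/eqP u0 /eqP u1]; apply/eqP/rowP => i; rewrite mxE.
by case: (unliftP ord0 i) => [j ->|->]; rewrite ?ord1.
Qed.

Lemma continuous_dotr u : continuous (dot u).
Proof.
have -> : dot u = fun v => u ord0 ord0 * v ord0 ord0 + u ord0 (lift ord0 ord0) * v ord0 (lift ord0 ord0).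
  by apply/funext => v; rewrite dotE.
have cont i : continuous (fun v : 'rV[R]_2 => u ord0 i * v ord0 i).
  by move=> v; apply: continuousM; [exact: cst_continuous|exact: coord_continuous].
by move=> v; exact: continuousD (cont _ v) (cont _ v).
Qed.

Lemma support_max K theta : convex_body K ->
  exists p, [/\ K p, support_function K theta = dot theta p &
    forall q, K q -> dot theta q <= dot theta p].
Proof.
move=> [K0 Kc _].
have [p /set_mem Kp pmax] := compact_EVT_max K0 Kc (continuous_subspaceT (@continuous_dotr theta)).
have {}pmax q : K q -> dot theta q <= dot theta p by move=> Kq; apply/pmax/mem_set.
exists p; split=> //; apply/le_anti/andP; split.
  by apply: ge_sup; [exists (dot theta p), p | move=> _ [q Kq <-]; exact: pmax].
by apply: ub_le_sup; [exists (dot theta p) => _ [q Kq <-]; exact: pmax | exists p].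
Qed.

Lemma dot_le_support K theta p : convex_body K -> K p -> dot theta p <= support_function K theta.
Proof. by move=> bK Kp; have [q [_ -> qmax]] := support_max theta bK; exact: qmax. Qed.

Lemma supportZ K c theta : convex_body K -> 0 < c ->
  support_function K (c *: theta) = c * support_function K theta.
Proof.
move=> bK c0; have [p [Kp -> pmax]] := support_max theta bK.
have [q [Kq -> qmax]] := support_max (c *: theta) bK.
apply/le_anti; rewrite !dotZl ler_pM2l // pmax //=.
by have := qmax _ Kp; rewrite !dotZl.
Qed.

(** With [B] a bound for [K], the support function is Lipschitz with constant [B * 2]; the norm is
    the sup norm and 2 counts the coordinates. *)
Lemma continuous_support K : convex_body K -> continuous (support_function K).
Proof.
move=> bK; have [_ Kc _] := bK.
have [B B0 KB] := ex_strict_bound_gt0 (compact_bounded Kc).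
have entry u i : `|u ord0 i| <= `|u|.
  rewrite [leRHS](_ : _ = mx_norm u) // mx_normrE.
  exact: (le_bigmax _ (fun i : 'I_1 * 'I_2 => `|u i.1 i.2|) (ord0, i)).
have dot_small u p : K p -> `|dot u p| <= `|u| * (B * 2).
  move=> Kp; rewrite dotE (le_trans (ler_normD _ _)) // !normrM.
  have Kp' := ltW (KB _ Kp); have le_p i := le_trans (entry p i) Kp'.
  by rewrite mulr2n mulrDr mulr1 mulrDr lerD // ler_pM.
have half u v : support_function K u - support_function K v <= `|u - v| * (B * 2).
  have [p [Kp -> _]] := support_max u bK.
  have := dot_le_support v bK Kp; have := dot_small (u - v) p Kp.
  rewrite dotDl dotNl ler_norml => /andP[_ h] h'; lra.
move=> u; apply/(@cvgrPdist_le _ _ _ (nbhs u) (nbhs_filter u)) => e e0.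
have d0 : 0 < e / (B * 2) by rewrite divr_gt0 ?mulr_gt0.
move: (nbhsx_ballx u _ d0); apply: filterS => v; rewrite -ball_normE /= => /ltW.
rewrite ler_pdivlMr ?mulr_gt0 // => uv.
rewrite ler_norml; have := half u v; have := half v u; rewrite (distrC v u).
by move=> h1 h2; apply/andP; split; lra.
Qed.

Lemma convex_setE K : @convex_set R 'rV[R]_2 K <->
  forall x y (a : R), 0 <= a <= 1 -> K x -> K y -> K (a *: x + (1 - a) *: y).
Proof.
split=> [cK x y a /andP[a0 a1] Kx Ky|cK x y l /set_mem Kx /set_mem Ky].
  have a01 : 0 <= a <= 1 by rewrite a0.
  by have := cK x y (Itv01 a0 a1) (mem_set Kx) (mem_set Ky) => /set_mem.
by apply/mem_set; apply: cK => //; rewrite ge0 le1.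
Qed.
End ConvexBodies.

(** * Hulls of finitely many bodies and separation of a point *)

Section Separation.
Variable R : realType.
Implicit Types (u v p q theta : 'rV[R]_2) (K A B C : set 'rV[R]_2).

Lemma convex_comb K x y (a b : R) : @convex_set R 'rV[R]_2 K -> 0 <= a -> 0 <= b ->
  K x -> K y -> exists2 z, K z & a *: x + b *: y = (a + b) *: z.
Proof.
move=> /convex_setE cK a0 b0 Kx Ky; have [ab0|ab0] := eqVneq (a + b) 0.
  exists x => //; move/eqP: ab0; rewrite paddr_eq0 // => /andP[/eqP-> /eqP->].
  by rewrite addr0 !scale0r addr0.
have ab_gt0 : 0 < a + b by rewrite lt_neqAle eq_sym ab0 addr_ge0.
exists ((a / (a + b)) *: x + (1 - a / (a + b)) *: y).
  apply: cK => //; rewrite divr_ge0 ?addr_ge0 //= ler_pdivrMr // mul1r lerDl //.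
rewrite scalerDr !scalerA; congr (_ *: _ + _ *: _); field; exact: ab0.
Qed.

(** For nonempty convex [A] and [B] this is the convex hull of their union, written as the image of
    a product so that compactness is inherited. *)
Definition join A B : set 'rV[R]_2 :=
  (fun w : R * 'rV[R]_2 * 'rV[R]_2 => w.1.1 *: w.1.2 + (1 - w.1.1) *: w.2) @`
    ((`[0, 1] `*` A) `*` B).

Lemma compact_join A B : compact A -> compact B -> compact (join A B).
Proof.
move=> cA cB; apply: continuous_compact; last first.
  by apply: compact_setX => //; apply: compact_setX => //; exact: segment_compact.
apply: continuous_subspaceT => w.
have c11 : (fun w : R * 'rV[R]_2 * 'rV[R]_2 => w.1.1) x @[x --> w] --> w.1.1.
  exact: (@cvg_comp _ _ _ fst fst _ _ _ cvg_fst cvg_fst).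
have c12 : (fun w : R * 'rV[R]_2 * 'rV[R]_2 => w.1.2) x @[x --> w] --> w.1.2.
  exact: (@cvg_comp _ _ _ fst snd _ _ _ cvg_fst cvg_snd).
have c2 : (fun w : R * 'rV[R]_2 * 'rV[R]_2 => w.2) x @[x --> w] --> w.2 by exact: cvg_snd.
apply: cvgD; first exact: cvgZ.
by apply: cvgZ => //; apply: cvgB => //; exact: cvg_cst.
Qed.

Lemma join_subl A B : B !=set0 -> A `<=` join A B.
Proof.
move=> [b Bb] a Aa; exists ((1, a), b) => /=; last by rewrite subrr scale0r scale1r addr0.
by rewrite /= in_itv /= ler01 lexx.
Qed.

Lemma join_subr A B : A !=set0 -> B `<=` join A B.
Proof.
move=> [a Aa] b Bb; exists ((0, a), b) => /=; last by rewrite subr0 scale0r scale1r add0r.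
by rewrite /= in_itv /= ler01 lexx.
Qed.

Lemma join_min A B M : @convex_set R 'rV[R]_2 M -> A `<=` M -> B `<=` M -> join A B `<=` M.
Proof.
move=> /convex_setE cM AM BM z [[[s a] b] /= [[+ Aa] Bb] <-].
by rewrite in_itv /= => s01; apply: cM => //; [exact: AM|exact: BM].
Qed.

Lemma convex_join A B : @convex_set R 'rV[R]_2 A -> @convex_set R 'rV[R]_2 B ->
  @convex_set R 'rV[R]_2 (join A B).
Proof.
move=> cA cB; apply/convex_setE => x y t /andP[t0 t1].
move=> [[[s a] b] /= [[sI Aa] Bb] <-] [[[s' a'] b'] /= [[s'I Aa'] Bb'] <-].
move: sI s'I; rewrite !in_itv /= => /andP[s0 s1] /andP[s'0 s'1].
have t1' : 0 <= 1 - t by rewrite subr_ge0.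
have [a2 Aa2 Ea] := convex_comb cA (mulr_ge0 t0 s0) (mulr_ge0 t1' s'0) Aa Aa'.
have s1' : 0 <= 1 - s by rewrite subr_ge0.
have s'1' : 0 <= 1 - s' by rewrite subr_ge0.
have [b2 Bb2 Eb] := convex_comb cB (mulr_ge0 t0 s1') (mulr_ge0 t1' s'1') Bb Bb'.
exists ((t * s + (1 - t) * s', a2), b2) => /=.
  split=> //; split=> //; rewrite in_itv /=; apply/andP; split; nra.
rewrite -Ea (_ : 1 - (_ + _) = t * (1 - s) + (1 - t) * (1 - s')); last by ring.
by rewrite -Eb !scalerDr !scalerA addrACA.
Qed.

(** Iterated joins keep the hull of finitely many bodies compact, which the separation of a point
    relies on. *)
Lemma finite_hull (I : eqType) (phi : I -> set 'rV[R]_2) (w : seq I) :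
  w != [::] -> (forall i, i \in w -> convex_body (phi i)) ->
  exists C, [/\ convex_body C, forall i, i \in w -> phi i `<=` C
    & forall M, @convex_set R 'rV[R]_2 M -> (forall i, i \in w -> phi i `<=` M) -> C `<=` M].
Proof.
elim: w => // i [|j w] IHw _ bw.
  exists (phi i); split; [apply: bw; exact: mem_head| |].
    by move=> j; rewrite inE => /eqP->.
  by move=> M _; apply; exact: mem_head.
have [||C [[C0 Cc Ccv] wC Cmin]] := IHw; first by [].
  by move=> l lw; apply: bw; rewrite inE lw orbT.
have [i0 ic icv] := bw i (mem_head _ _).
exists (join (phi i) C); split.
- split; [|exact: compact_join|exact: convex_join].
  by have [a ia] := i0; exists a; exact: join_subl ia.
- move=> l; rewrite inE => /predU1P[->|lw]; first exact: join_subl.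
  exact: subset_trans (wC _ lw) (@join_subr _ _ i0).
move=> M cM HM; apply: join_min => //; first exact/HM/mem_head.
by apply: Cmin => // l lw; apply: HM; rewrite inE lw orbT.
Qed.

(** The direction is [p - q], where [q] is a point of [C] at least Euclidean distance from [p]. *)
Lemma separate_point C p : convex_body C -> ~ C p ->
  exists theta, forall c, C c -> dot theta c < dot theta p.
Proof.
move=> [C0 Cc Ccv] nCp; have cC := (convex_setE C).1 Ccv.
have dist_cont : continuous (fun c : 'rV[R]_2 => dot (p - c) (p - c)).
  have -> : (fun c : 'rV[R]_2 => dot (p - c) (p - c)) = fun c : 'rV[R]_2 =>
      (p ord0 ord0 - c ord0 ord0) * (p ord0 ord0 - c ord0 ord0) +
      (p ord0 (lift ord0 ord0) - c ord0 (lift ord0 ord0)) * (p ord0 (lift ord0 ord0) - c ord0 (lift ord0 ord0)).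
    by apply/funext => c; rewrite dotE !mxE.
  have cB i : continuous (fun c : 'rV[R]_2 => p ord0 i - c ord0 i).
    move=> c; have c1 : {for c, continuous (fun=> p ord0 i)} by exact: cst_continuous.
    have c2 : {for c, continuous (fun c : 'rV[R]_2 => c ord0 i)} by exact: coord_continuous.
    exact: continuousB c1 c2.
  have cM i : continuous (fun c : 'rV[R]_2 => (p ord0 i - c ord0 i) * (p ord0 i - c ord0 i)).
    by move=> c; exact: continuousM (cB i c) (cB i c).
  by move=> c; exact: continuousD (cM _ c) (cM _ c).
have [q /set_mem Cq qmin] := compact_EVT_min C0 Cc (continuous_subspaceT dist_cont).
have pq0 : p - q != 0 by rewrite subr_eq0; apply: contra_notN nCp => /eqP->.
exists (p - q) => c Cc'.
have qp : dot (p - q) q < dot (p - q) p.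
  by rewrite -subr_gt0; have := dot_gt0 pq0; rewrite dotDr [dot _ (- q)]dotC dotNl [dot q _]dotC.
apply: le_lt_trans qp; rewrite -subr_le0 leNgt; apply/negP => pos.
set D := dot (p - q) c - dot (p - q) q in pos.
set N := dot (c - q) (c - q).
have N0 : 0 <= N by rewrite /N dotE -!expr2 addr_ge0 ?sqr_ge0.
(* Moving from q towards c by e would bring the point closer to p. *)
pose e := D / (D + N).
have DN : 0 < D + N by lra.
have e0 : 0 < e by rewrite divr_gt0.
have e1 : e <= 1 by rewrite ler_pdivrMr // mul1r; lra.
have Cz : C (e *: c + (1 - e) *: q) by apply: cC => //; rewrite (ltW e0).
have := qmin _ (mem_set Cz).
have -> : dot (p - (e *: c + (1 - e) *: q)) (p - (e *: c + (1 - e) *: q)) =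
    dot (p - q) (p - q) - 2 * e * D + e * e * N.
  by rewrite /D /N !dotE !mxE; ring.
have eN : e * (D + N) = D by rewrite /e mulfVK // gt_eqF.
have eD : 0 < e * D by exact: mulr_gt0.
have eN' : e * N < D by move: eN; rewrite mulrDr; lra.
have : 0 < e * (D + (D - e * N)) by rewrite mulr_gt0 //; lra.
by rewrite mulrDr mulrBr; nra.
Qed.

Lemma separating_direction (I : eqType) (phi : I -> set 'rV[R]_2) (w : seq I) K :
  w != [::] -> convex_body K -> (forall i, i \in w -> convex_body (phi i)) ->
  ~ K `<=` convex_hull (\bigcup_(i in [set` w]) phi i) ->
  exists theta, forall i, i \in w -> support_function (phi i) theta < support_function K theta.
Proof.
move=> w0 bK bw /existsNP[p /not_implyP[Kp np]].
have [C [bC wC Cmin]] := finite_hull w0 bw.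
have nCp : ~ C p.
  move=> Cp; apply: np => M [cM HM]; apply: Cmin Cp => // i iw q iq.
  by apply: HM; exists i.
have [theta thetaP] := separate_point bC nCp; exists theta => i iw.
apply: lt_le_trans (dot_le_support theta bK Kp).
have [q [iq -> _]] := support_max theta (bw i iw).
exact/thetaP/(wC _ iw).
Qed.

End Separation.

(** * Sampling directions *)

Lemma card_seq (T : eqType) (l : seq T) : uniq l -> [set` l] #= `I_(size l).
Proof.
case: l => [|x0 l] l_uniq; first by rewrite set_nil II0.
have inj : {in `I_(size (x0 :: l)) &, injective (nth x0 (x0 :: l))}.
  by move=> i j /set_mem il /set_mem jl /eqP; rewrite nth_uniq // => /eqP.
suff -> : [set` x0 :: l] = nth x0 (x0 :: l) @` `I_(size (x0 :: l)) by exact: inj_card_eq.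
apply/seteqP; split=> [x|_ [i il <-]]; last exact: mem_nth.
move=> xl; exists (index x (x0 :: l)); last by rewrite nth_index.
by rewrite /mkset index_mem.
Qed.

Lemma card_seq_le (T : eqType) (l : seq T) (A : set T) m : uniq l ->
  {in l, forall x, A x} -> A #<= `I_m -> (size l <= m)%N.
Proof.
move=> l_uniq lA Am; rewrite -card_le_II -(card_le_eql (card_seq l_uniq)).
apply: card_le_trans Am; apply: subset_card_le => x xl; exact: lA.
Qed.

(** * Parametrised directions and sign changes *)

Section Parametrisation.
Variable R : realType.
Implicit Types (u v p q theta : 'rV[R]_2) (K L : set 'rV[R]_2) (tau : R).

(* Stereographic parametrisation, up to the positive factor 1 + tau^2, of all directions but (-1, 0). *)
Definition dir tau : 'rV[R]_2 := \row_i (if i == ord0 then 1 - tau ^+ 2 else 2 * tau).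

Lemma dir0E tau : dir tau ord0 ord0 = 1 - tau ^+ 2.
Proof. by rewrite mxE eqxx. Qed.

Lemma dir1E tau : dir tau ord0 (lift ord0 ord0) = 2 * tau.
Proof. by rewrite mxE. Qed.

Lemma rV2P u v : u ord0 ord0 = v ord0 ord0 ->
  u ord0 (lift ord0 ord0) = v ord0 (lift ord0 ord0) -> u = v.
Proof.
by move=> uv0 uv1; apply/rowP => i; case: (unliftP ord0 i) => [j ->|->]; rewrite ?ord1.
Qed.

Lemma continuous_dir : continuous dir.
Proof.
have -> : dir = fun tau => (1 - tau * tau) *: dir 0 + tau *: (\row_i (if i == ord0 then 0 else 2)).
  apply/funext => tau; by apply: rV2P; rewrite !mxE /=; ring.
move=> tau; apply: cvgD; apply: cvgZ; try exact: cvg_cst; last exact: cvg_id.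
by apply: cvgB; [exact: cvg_cst|apply: cvgM; exact: cvg_id].
Qed.

Definition unit_dir tau := (1 + tau ^+ 2)^-1 *: dir tau.

Let den_gt0 tau : 0 < 1 + tau ^+ 2.
Proof. by rewrite ltr_pwDl // sqr_ge0. Qed.

Lemma unit_dir_circle tau : @unit_circle R (unit_dir tau).
Proof.
rewrite /unit_circle /= dotZl dotZr dotE dir0E dir1E.
by field; rewrite gt_eqF // den_gt0.
Qed.

Lemma unit_dir_inj : injective unit_dir.
Proof.
move=> s t st; have d0 := den_gt0 s; have d1 := den_gt0 t.
have := congr1 (fun u : 'rV[R]_2 => 1 + u ord0 ord0) st.
have := congr1 (fun u : 'rV[R]_2 => u ord0 (lift ord0 ord0)) st.
rewrite /= ![unit_dir _ _ _]mxE !dir0E !dir1E.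
(* The first coordinate determines the denominator; the second one then determines the parameter. *)
have e x : 0 < 1 + x ^+ 2 -> 1 + (1 + x ^+ 2)^-1 * (1 - x ^+ 2) = 2 * (1 + x ^+ 2)^-1 :> R.
  by move=> x0; field; rewrite gt_eqF.
rewrite !e // => E1 /(mulfI (_ : 2 != 0)) E2.
move: E1; rewrite E2 ?pnatr_eq0 // => /(mulfI _) E1.
by apply: (mulfI (_ : 2 != 0)); rewrite ?pnatr_eq0 // E1 // invr_eq0 gt_eqF.
Qed.

Lemma common_tangent_unit_dir K L tau : convex_body K -> convex_body L ->
  support_function K (dir tau) = support_function L (dir tau) ->
  common_tangents K L (unit_dir tau).
Proof.
by move=> bK bL KL; split; [exact: unit_dir_circle|rewrite !supportZ ?invr_gt0 ?den_gt0 ?KL].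
Qed.

Lemma finite_tangent_params K L m : convex_body K -> convex_body L ->
  common_tangents K L #<= `I_m ->
  finite_set [set tau | support_function K (dir tau) = support_function L (dir tau)].
Proof.
move=> bK bL KLm; have fin : finite_set (common_tangents K L).
  by apply/finite_set_leP; exists m.
apply: sub_finite_set (finite_preimage _ fin) => [tau|].
  exact: common_tangent_unit_dir.
by move=> s t _ _; exact: unit_dir_inj.
Qed.

Lemma nbhs_avoid (x : R) (U B : set R) : nbhs x U -> finite_set B ->
  exists2 y, U y & ~ B y.
Proof.
move=> xU Bfin; have lim : limit_point setT x.
  move=> V /nbhs_ballP[e /= e0 eV]; exists (x + e / 2); split=> //.
    by rewrite -subr_eq0 addrAC subrr add0r gt_eqF // divr_gt0.
  apply: eV; rewrite -ball_normE /= opprD addrA subrr add0r normrN ger0_norm; lra.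
have := (limit_point_infinite_setP _ _).1 lim _ xU; rewrite setIT => Uinf.
by have [y [Uy nBy]] := infinite_setN0 (infinite_setD Uinf Bfin); exists y.
Qed.

Lemma nbhs_support_lt (I : eqType) (phi : I -> set 'rV[R]_2) (w : seq I) K theta :
  convex_body K -> (forall i, i \in w -> convex_body (phi i)) ->
  (forall i, i \in w -> support_function (phi i) theta < support_function K theta) ->
  nbhs theta [set v | forall i, i \in w -> support_function (phi i) v < support_function K v].
Proof.
move=> bK; elim: w => [|i w IHw] bw ltw.
  by apply: filterS (@filterT _ (nbhs theta) _).
have sub l : l \in w -> l \in i :: w by rewrite inE => ->; rewrite orbT.
have {}IHw := IHw (fun l lw => bw l (sub l lw)) (fun l lw => ltw l (sub l lw)).
have diff : {for theta, continuous (support_function K - support_function (phi i))}.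
  apply: continuousB; apply: continuous_support => //; exact/bw/mem_head.
have pos : 0 < (support_function K - support_function (phi i)) theta.
  by rewrite subr_gt0; apply: ltw; exact: mem_head.
have near_i := @cvgr_gt _ _ _ (nbhs_filter theta) _ _ diff _ pos.
apply: filterS2 near_i IHw => v; rewrite subr_gt0 => vi vw l.
by rewrite inE => /predU1P[->|]; [|exact: vw].
Qed.

(** The strict inequalities are an open condition. A first perturbation makes the second coordinate
    nonzero, away from the direction (-1, 0) that [dir] misses; a second one, of the parameter,
    avoids [B]. *)
Lemma param_direction (I : eqType) (phi : I -> set 'rV[R]_2) (w : seq I) K theta (B : set R) :
  convex_body K -> (forall i, i \in w -> convex_body (phi i)) ->
  (forall i, i \in w -> support_function (phi i) theta < support_function K theta) ->
  finite_set B -> exists2 tau, ~ B tau &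
    forall i, i \in w -> support_function (phi i) (dir tau) < support_function K (dir tau).
Proof.
move=> bK bw ltw Bfin.
have W := nbhs_support_lt bK bw ltw.
pose e1 : 'rV[R]_2 := \row_i (if i == ord0 then 0 else 1).
pose path (e : R) := theta + e *: e1.
have path_cont : path x @[x --> (0 : R)] --> theta.
  rewrite -[X in _ --> X]addr0 -(scale0r e1).
  by apply: cvgD; [exact: cvg_cst|apply: cvgZ; [exact: cvg_id|exact: cvg_cst]].
have [e We e_neq] := nbhs_avoid (path_cont _ W) (finite_set1 (- theta ord0 (lift ord0 ord0))).
set v := path e in We.
pose a := v ord0 ord0; pose b := v ord0 (lift ord0 ord0).
have b0 : b != 0.
  apply/eqP => b0; apply: e_neq; move: b0; rewrite /b /v /path !mxE /= mulr1.
  by move/eqP; rewrite addrC addr_eq0 => /eqP.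
pose r := Num.sqrt (a ^+ 2 + b ^+ 2).
have b2 : 0 < b ^+ 2 by rewrite exprn_even_gt0.
have a2 : 0 <= a ^+ 2 by exact: sqr_ge0.
have r2 : r ^+ 2 = a ^+ 2 + b ^+ 2 by rewrite sqr_sqrtr // addr_ge0 // ltW.
have r0 : 0 <= r by exact: sqrtr_ge0.
have ra : 0 < r + a.
  by rewrite ltNge; apply/negP => ra; move: r2 b2; rewrite !expr2; nra.
(* The tangent of half the angle of [v]; [r + a] is positive because [b] is nonzero. *)
pose tau0 := b / (r + a).
have vE : v = ((r + a) / 2) *: dir tau0.
  apply: rV2P; rewrite -/a -/b [RHS]mxE ?dir0E ?dir1E /tau0.
    have -> : (b / (r + a)) ^+ 2 = (r - a) / (r + a).
      have -> : (b / (r + a)) ^+ 2 = b ^+ 2 / (r + a) ^+ 2 by rewrite expr_div_n.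
      have -> : b ^+ 2 = (r - a) * (r + a) by rewrite -subr_sqr r2 addrAC subrr add0r.
      by field; rewrite gt_eqF.
    by field; rewrite gt_eqF.
  by field; rewrite gt_eqF.
have W0 i : i \in w -> support_function (phi i) (dir tau0) < support_function K (dir tau0).
  have {}We i' : i' \in w -> support_function (phi i') v < support_function K v := We i'.
  move=> iw; have := We i iw; rewrite vE !supportZ ?divr_gt0 //; last exact: bw.
  by rewrite ltr_pM2l // divr_gt0.
have W1 := nbhs_support_lt bK bw W0.
by have [tau Wt nB] := nbhs_avoid (@continuous_dir tau0 _ W1) Bfin; exists tau.
Qed.

(* The default value closes up the cycle: beyond the last sample one is back at the first. *)
Definition sample (ts : seq R) t := nth (nth 0 ts 0) ts t.

(** By the intermediate value theorem each change between consecutive samples yields a common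
    tangent, and these are distinct. The closing step back to the first sample adds at most one
    change; since the total around the cycle is even, the even bound [m] persists. *)
Lemma size_sign_changes K L (ts : seq R) m : convex_body K -> convex_body L ->
  common_tangents K L #<= `I_m -> ~~ odd m -> sorted <%R ts ->
  {in ts, forall tau, support_function K (dir tau) <> support_function L (dir tau)} ->
  (size (changes (fun t => support_function K (dir (sample ts t)) <
                           support_function L (dir (sample ts t)))%R (size ts)) <= m)%N.
Proof.
move=> bK bL KLm m_even ts_sorted ts_neq; set I := (fun t => _).
set sigma := sample ts; case Dts : (size ts) => [//|D].
have sizeD : (size (changes I D) <= m)%N.
  pose h tau := support_function K (dir tau) - support_function L (dir tau).
  have h_cont : continuous h.
    move=> tau; have cK : {for tau, continuous (support_function K \o dir)}.
      by apply: continuous_comp; [exact: continuous_dir|exact: continuous_support].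
    have cL : {for tau, continuous (support_function L \o dir)}.
      by apply: continuous_comp; [exact: continuous_dir|exact: continuous_support].
    exact: continuousB cK cL.
  have sigma_ts t : (t <= D)%N -> sigma t \in ts by move=> tD; apply: mem_nth; rewrite Dts.
  have h_neq t : (t <= D)%N -> h (sigma t) != 0.
    by move=> tD; rewrite subr_eq0; apply/eqP/ts_neq/sigma_ts.
  have sigma_lt s t : (s < t)%N -> (t <= D)%N -> sigma s < sigma t.
    move=> st tD; apply: (sorted_ltn_nth lt_trans) => //; rewrite inE Dts ltnS //.
    exact: leq_trans (ltnW st) tD.
  have zero t : exists z, t \in changes I D -> [/\ sigma t.-1 < z, z < sigma t & h z = 0].
    have [tc|] := boolP (t \in changes I D); last by exists 0.
    move: tc; rewrite mem_filter mem_iota add1n ltnS => /andP[It /andP[t_gt0 tD]].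
    have lt_t : sigma t.-1 < sigma t by apply: sigma_lt; rewrite // prednK.
    have t1D : (t.-1 <= D)%N by rewrite (leq_trans (leq_pred t)).
    have sgn : Num.min (h (sigma t.-1)) (h (sigma t)) <= 0 <= Num.max (h (sigma t.-1)) (h (sigma t)).
      have I_h s : I s = (h (sigma s) < 0) by rewrite subr_lt0.
      rewrite ge_min le_max; move: It; rewrite !I_h.
      by case: (ltP (h (sigma t)) 0) => [/ltW->|_]; case: (ltP (h (sigma t.-1)) 0) => [/ltW->|_];
        rewrite ?orbT.
    have [z zI hz] := IVT (ltW lt_t) (continuous_subspaceT h_cont) sgn.
    exists z => _; move: zI; rewrite in_itv /= => /andP[z0 z1]; split=> //.
      rewrite lt_neqAle z0 andbT; apply/eqP => E; move: (h_neq _ t1D).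
      by rewrite E hz eqxx.
    rewrite lt_neqAle z1 andbT; apply/eqP => E; move: (h_neq _ tD).
    by rewrite -E hz eqxx.
  have [z zP] := choice zero.
  have z_lt s t : s \in changes I D -> t \in changes I D -> (s < t)%N -> z s < z t.
    move=> sc tc st; have [_ zs _] := zP s sc; have [zt _ _] := zP t tc.
    apply: lt_trans zs (le_lt_trans _ zt).
    have tD : (t <= D)%N by move: tc; rewrite mem_filter mem_iota add1n ltnS => /and3P[].
    have : (s <= t.-1)%N by rewrite -ltnS prednK // (leq_ltn_trans _ st).
    rewrite leq_eqVlt => /predU1P[->//|st1]; apply/ltW/sigma_lt => //.
    exact: leq_trans (leq_pred t) tD.
  rewrite -(size_map (unit_dir \o z)); apply: card_seq_le KLm.
    rewrite map_inj_in_uniq ?filter_uniq ?iota_uniq // => s t sc tc /unit_dir_inj zst.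
    case: (ltngtP s t) => // [st|ts']; [have := z_lt s t sc tc st|have := z_lt t s tc sc ts'];
      by rewrite zst ltxx.
  move=> _ /mapP[t tc ->]; apply: common_tangent_unit_dir => //.
  by have [_ _ /eqP] := zP t tc; rewrite subr_eq0 => /eqP.
have even : odd (size (changes I D.+1)) = false.
  have eq0 : sample ts D.+1 = sample ts 0.
    by rewrite /sample nth_default ?Dts // (set_nth_default 0) // Dts.
  by rewrite odd_size_changes /I eq0 eqxx.
have : (size (changes I D.+1) <= (size (changes I D)).+1)%N.
  rewrite /changes (_ : iota 1 D.+1 = iota 1 D ++ [:: D.+1]); last first.
    by rewrite -[RHS](iotaD 1 D 1) addn1.
  by rewrite filter_cat size_cat /=; case: ifP => _ /=; rewrite ?addn1 ?addn0 ?leqnSn.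
move=> sizeS; have : size (changes I D.+1) <> m.+1.
  by move=> E; move: even m_even; rewrite E /= => ->.
clear - sizeS sizeD; lia.
Qed.

End Parametrisation.

(** * From families of bodies to sequences of orders *)

Lemma exists_forces (R : realType) (k n : nat) : (0 < k)%N ->
  exists h, (0 < h)%N /\ forces_convex_position R k n h.
Proof.
move=> k_gt0; have [N NP] := convex_subfamily n k_gt0.
(* The successor makes the bound positive and the index type inhabited. *)
exists N.+1; split=> // F [bodies tangents conv_m] /pcard_leP[f].
pose T := 'I_N.+1; pose phi (i : T) := f i.
have phiF i : F (phi i) by apply: funS; exact: ltn_ord.
have phi_inj : injective phi.
  move=> i j /inj; rewrite !inE => ij; apply: val_inj; apply: ij; exact: ltn_ord.
have bphi i : convex_body (phi i) by exact: bodies.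
have card_phi (u : seq T) : uniq u -> phi @` [set` u] #= `I_(size u).
  move=> /card_seq u_card; rewrite -(card_eqr u_card).
  by apply: inj_card_eq => i j _ _; exact: phi_inj.
pose g (i : T) tau := support_function (phi i) (dir tau).
(* Off this finite set of parameters the support values order the chosen bodies linearly. *)
pose bad := \bigcup_(ij in [set ij : T * T | ij.1 != ij.2]) [set tau | g ij.1 tau = g ij.2 tau].
have bad_fin : finite_set bad.
  apply: bigcup_finite => [|[i j] /= ij]; first exact: finite_finset.
  apply: (finite_tangent_params (m := 2 * k)) => //; apply: tangents => //.
  by move=> /phi_inj/eqP; exact/negP.
have not_bad tau i j : ~ bad tau -> i != j -> g i tau <> g j tau.
  by move=> nb ij gij; apply: nb; exists (i, j).
(* Finitely many pairs [Ax] suffice to keep the convex position of all [m_ k]-tuples visible in the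
   samples; irrelevant pairs get any parameter outside [bad]. *)
have witness (Ax : {set T} * T) : exists tau, ~ bad tau /\ (#|Ax.1| = m_ k -> Ax.2 \in Ax.1 ->
    forall y, y \in Ax.1 -> y != Ax.2 -> g y tau < g Ax.2 tau).
  case: Ax => A x /=.
  have [tau0 _ nbad0] := nbhs_avoid (@filterT _ (nbhs (0 : R)) _) bad_fin.
  have [[Am xA]|nA] := pselect (#|A| = m_ k /\ x \in A); last first.
    by exists tau0; split=> // Am xA; case: nA.
  pose w := enum (A :\ x)%SET.
  have memw y : (y \in w) = (y != x) && (y \in A) by rewrite mem_enum !inE.
  have w0 : w != [::].
    rewrite -size_eq0 -cardE; have := cardsD1 x A; rewrite Am xA.
    by have := m_ge3 k; case: #|_| => [|//]; case: (m_ k) => [|[|]].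
  have GA : phi @` [set` enum A] #= `I_(m_ k).
    by rewrite -Am cardE; exact/card_phi/enum_uniq.
  have GF : phi @` [set` enum A] `<=` F by move=> _ [i _ <-]; exact: phiF.
  have Gx : (phi @` [set` enum A]) (phi x) by exists x => //=; rewrite mem_enum.
  have := conv_m _ GF GA _ Gx.
  have -> : \bigcup_(L in phi @` [set` enum A] `\ phi x) L = \bigcup_(i in [set` w]) phi i.
    apply/seteqP; split=> p.
      move=> [_ [[i /= + <-] ix] ip]; rewrite mem_enum => iA; exists i => //=.
      by rewrite memw iA andbT; apply/eqP => E; apply: ix; rewrite E.
    move=> [i /=]; rewrite memw => /andP[ix iA] ip; exists (phi i) => //; split.
      by exists i => //=; rewrite mem_enum.
    by move=> /phi_inj/eqP; exact/negP.
  move=> /(separating_direction w0 (bphi x) (fun i _ => bphi i))[theta theta_lt].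
  have [tau nbad tau_lt] := param_direction (bphi x) (fun i _ => bphi i) theta_lt bad_fin.
  by exists tau; split=> // _ _ y yA yx; apply: tau_lt; rewrite memw yx.
have [W WP] := choice witness.
pose ts := sort <=%R (undup [seq W Ax | Ax : {set T} * T]).
have ts_sorted : sorted <%R ts by rewrite sort_lt_sorted undup_uniq.
have W_ts Ax : W Ax \in ts by rewrite mem_sort mem_undup; apply/mapP; exists Ax; rewrite ?mem_enum.
have ts_good tau : tau \in ts -> ~ bad tau.
  by rewrite mem_sort mem_undup => /mapP[Ax _ ->]; have [] := WP Ax.
have ts_gt0 : (0 < size ts)%N by have := W_ts (finset.set0, ord0); case: (ts).
have sample_ts t : sample ts t \in ts.
  rewrite /sample; have [ht|ht] := ltnP t (size ts); first exact: mem_nth.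
  by rewrite nth_default // mem_nth.
pose up t : rel T := fun i j => g i (sample ts t) < g j (sample ts t).
have [|||||||u [u_uniq _ u_n u_conv]] := NP T up (enum T) (size ts).
- exact: enum_uniq.
- by rewrite size_enum_ord.
- by move=> t j i l; exact: lt_trans.
- move=> t i j _ _ ij; rewrite /up -leNgt lt_neqAle andb_idl // => _.
  exact/eqP/(not_bad _ _ _ (ts_good _ (sample_ts t)) ij).
- by move=> t tD; rewrite /up /sample nth_default // (set_nth_default 0).
- move=> i j _ _ ij; apply: size_sign_changes => //.
  + by apply: tangents => // /phi_inj/eqP; exact/negP.
  + by rewrite oddM.
  + by move=> tau tau_ts; exact: not_bad (ts_good _ tau_ts) ij.
- move=> u u_uniq _ u_m x xu.
  have := WP (finset.finset (mem u), x); set tau := W _ => -[_ /=].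
  rewrite cardsE (card_uniqP u_uniq) inE => /(_ u_m xu) top_x.
  exists (index tau ts); apply/(is_topP _ _ _ u_uniq) => y yu yx.
  by rewrite /up /sample nth_index ?W_ts //; apply: top_x; rewrite ?inE.
exists (phi @` [set` u]); split.
- by move=> _ [i _ <-]; exact: phiF.
- by rewrite -u_n; exact: card_phi.
move=> _ [x /= xu <-] sub.
have [t /(is_topP _ _ _ u_uniq) top_x] := u_conv x xu.
set theta := dir (sample ts t).
have [p [xp gp _]] := support_max theta (bphi x).
have hull_p : (convex_hull (\bigcup_(L in phi @` [set` u] `\ phi x) L)) p by exact: sub.
suff : dot theta p < dot theta p by rewrite ltxx.
(* This open half-plane is convex and contains the other bodies, hence their hull, but not the point
   [p] where [phi x] attains its support value. *)
apply: (hull_p [set q | dot theta q < dot theta p]); split.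
  apply/convex_setE => a b s /andP[s0 s1] /= alt blt; rewrite dotDr !dotZr.
  have [->|s_neq0] := eqVneq s 0; first by rewrite mul0r add0r subr0 mul1r.
  have s_gt0 : 0 < s by rewrite lt_neqAle eq_sym s_neq0.
  have : 0 < s * (dot theta p - dot theta a) by rewrite mulr_gt0 // subr_gt0.
  have : 0 <= (1 - s) * (dot theta p - dot theta b) by rewrite mulr_ge0 ?subr_ge0 // ltW.
  by rewrite !mulrBr !mulrBl !mul1r; lra.
move=> q [_ [[i /= iu <-] ix] iq]; rewrite /= -gp.
apply: le_lt_trans (dot_le_support theta (bphi i) iq) _.
by apply: top_x => //; apply/eqP => E; apply: ix; rewrite E.
Qed.

Theorem theorem1p1 (R : realType) (k n : nat) (k_ge1 : (1 <= k)%N)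
    (k_lt_n : (k < n)%N) :
  exists h : nat,
    [/\ (0 < h)%N,
        forces_convex_position R k n h
      & forall h' : nat, (0 < h')%N -> forces_convex_position R k n h' ->
          (h <= h')%N].
Proof.
have [h0 [h0_gt0 h0P]] := @exists_forces R k n k_ge1.
have ex : exists h, (0 < h)%N && `[< forces_convex_position R k n h >].
  by exists h0; rewrite h0_gt0; apply/asboolP.
case: (ex_minnP ex) => h /andP[h_gt0 /asboolP hP] hmin.
exists h; split=> // h' h'_gt0 h'P; apply: hmin; rewrite h'_gt0.
exact/asboolP.
Qed.
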